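(* Let $G$ be a Polish group and let $X$ be a minimal $G$-ED flow. Then the following are equivalent: (1) $X$ satisfies the Rosendal criterion. (2) $X$ has a comeager orbit. (3) $X$ has a point of first-countability. (4) $X$ has a $G$-isolated point. (5) For any compatible right-invariant metric $d$ on $G$, there is a $\partial_d$-compatible point in $X$. (6) For some closed, presyndetic subgroup $H\leq G$, we have $X\cong \mathrm{Sa}(G/H)$ (as $G$-flows). In particular, for a Polish group $G$, we have $G\in\mathsf{TMD}$ if and only if $G\in\mathsf{GPP}$.
   Context: All topological spaces are Hausdorff and regular. For a topological group $G$, a $G$-flow is a compact space with a continuous left $G$-action $G\times X\to X$; it is minimal if every orbit is dense. A $G$-map is a continuous $G$-equivariant map. The universal minimal flow $\mathrm{M}(G)$ is the (unique up to isomorphism) minimal $G$-flow admitting a $G$-map onto every minimal $G$-flow. A $G$-flow $X$ is $G$-ED if $\overline{A}\subseteq\mathrm{Int}(\overline{UA})$ for every open $A\subseteq X$ and every neighborhood $U$ of $e_G$. ($\mathrm{M}(G)$ is always $G$-ED.) For a symmetric open neighborhood $U$ of $e_G$, a nonempty open $A\subseteq X$ is $U$-TT if $A\subseteq\overline{UB}$ for every nonempty open $B\subseteq A$. $X$ satisfies the Rosendal criterion if for every such $U$, every nonempty open $A\subseteq X$ contains a nonempty open $U$-TT set. $\mathsf{TMD}$ is the class of topological groups $G$ such that $\mathrm{M}(G)$ satisfies the Rosendal criterion. $\mathsf{GPP}$ is the class of Polish groups $G$ such that every minimal $G$-flow has a comeager orbit (equivalently, $\mathrm{M}(G)$ has a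 comeager orbit). A point $x\in X$ is $G$-isolated if for every symmetric open neighborhood $U$ of $e_G$ we have $x\in\mathrm{Int}(Q_U[x])$, where $Q_U[x]=\bigcap\{\overline{UA}: A\subseteq X\text{ open},\ x\in\overline{A}\}$. For a compatible right-invariant metric $d$ on $G$, write $\mathrm{B}_d(c)=\{g: d(g,e_G)<c\}$; $\partial_d$ is the function on $X\times X$ given, for $c\in[0,\infty)$, by $\partial_d(x,y)\le c$ iff for all $\epsilon>0$ and all open $A\ni x$, $y\in\overline{\mathrm{B}_d(c+\epsilon)\cdot A}$. On a $G$-ED flow it is a lower semi-continuous pseudometric. A point $x$ is $\partial_d$-compatible if $x\in\mathrm{Int}(\{z:\partial_d(x,z)<c\})$ for every $c>0$. A closed subgroup $H\le G$ is presyndetic if for every neighborhood $U$ of $e_G$ there is a finite $F\subseteq G$ with $FUH=G$. $G/H$ carries the right uniformity generated by the entourages $\{(gH,kH): gH\in UkH\}$, $U$ a neighborhood of $e_G$ (here $UkH$ is viewed as the set of cosets $ukH$, $u\in U$); $\mathrm{Sa}(G/H)$ is its Samuel compactification (the Gelfand dual of the algebra of bounded uniformly continuous functions on $G/H$), a $G$-flow under the extension of the left translation action. *)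

(* Defs.v *)
From HB Require Import structures.
From mathcomp Require Import all_boot all_order all_algebra.
From mathcomp Require Import all_classical all_reals.
From mathcomp Require Import ereal topology normedtype sequences.

Set Implicit Arguments.
Unset Strict Implicit.
Unset Printing Implicit Defensive.

Import Order.TTheory GRing.Theory Num.Theory.
Import numFieldNormedType.Exports.

Local Open Scope classical_set_scope.
Local Open Scope ring_scope.

HB.mixin Record isTopologicalGroup G of Group G & Topological G := {
  mulg_continuous : continuous (fun p : G * G => (p.1 * p.2)%g);
  invg_continuous : continuous (fun x : G => (x^-1)%g)
}.

#[short(type="topGroupType")]
HB.structure Definition TopGroup :=
  {G of Group G & Topological G & isTopologicalGroup G}.

Definition symmetric_set (G : groupType) (U : set G) : Prop :=
  forall u, U u -> U (u^-1)%g.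

Definition is_subgroup (G : groupType) (H : set G) : Prop :=
  [/\ H 1%g, forall x y, H x -> H y -> H (x * y)%g
    & forall x, H x -> H (x^-1)%g].

Definition mulset (G : groupType) (A B : set G) : set G :=
  [set (a * b)%g | a in A & b in B].

Definition presyndetic (G : topGroupType) (H : set G) : Prop :=
  forall U : set G, nbhs (1%g : G) U ->
  exists F : set G, finite_set F /\ mulset (mulset F U) H = [set: G].

Definition is_metric (R : realType) (T : Type) (d : T -> T -> R) : Prop :=
  [/\ forall x y, 0 <= d x y,
      forall x y, d x y = 0 <-> x = y,
      forall x y, d x y = d y x
    & forall x y z, d x z <= d x y + d y z].

Definition compatible_metric (R : realType) (T : topologicalType)
    (d : T -> T -> R) : Prop :=
  is_metric d /\
  forall (x : T) (A : set T),
    nbhs x A <-> exists2 e : R, 0 < e & [set y | d x y < e] `<=` A.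

Definition right_invariant (R : realType) (G : groupType) (d : G -> G -> R) :
  Prop := forall x y g, d (x * g)%g (y * g)%g = d x y.

Definition complete_metric (R : realType) (T : topologicalType)
    (d : T -> T -> R) : Prop :=
  forall u : nat -> T,
    (forall e : R, 0 < e ->
       exists N, forall m n, (N <= m)%N -> (N <= n)%N -> d (u m) (u n) < e) ->
    exists l : T, u @ \oo --> l.

Definition polish (R : realType) (T : topologicalType) : Prop :=
  (exists S : set T, countable S /\ dense S) /\
  (exists d : T -> T -> R, compatible_metric d /\ complete_metric d).

Definition nowhere_dense (T : topologicalType) (A : set T) : Prop :=
  interior (closure A) = set0.

Definition meager (T : topologicalType) (A : set T) : Prop :=
  exists F : nat -> set T,
    (forall n, nowhere_dense (F n)) /\ A = \bigcup_n F n.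

Definition comeager (T : topologicalType) (A : set T) : Prop := meager (~` A).

Definition first_countable_at (T : topologicalType) (x : T) : Prop :=
  exists B : nat -> set T,
    (forall n, nbhs x (B n)) /\
    forall A, nbhs x A -> exists n, B n `<=` A.

Record gflow (G : topGroupType) := GFlow {
  gflow_space :> topologicalType;
  gact : G -> gflow_space -> gflow_space;
  gact1 : forall x, gact 1%g x = x;
  gactM : forall g h x, gact (g * h)%g x = gact g (gact h x);
  gact_continuous : continuous (fun p : G * gflow_space => gact p.1 p.2);
  gflow_compact : compact [set: gflow_space];
  gflow_hausdorff : hausdorff_space gflow_space
}.

Section Flows.
Variables (G : topGroupType) (X Y : gflow G).

Definition gmap (f : X -> Y) : Prop :=
  continuous f /\ forall g x, f (gact g x) = gact g (f x).

Definition setact (U : set G) (A : set X) : set X :=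
  [set gact u x | u in U & x in A].

Definition orbit (x : X) : set X := range (fun g => gact g x).

(* Without the first conjunct the empty flow would be minimal. *)
Definition minimal_flow : Prop :=
  [set: X] !=set0 /\ forall x : X, dense (orbit x).

Definition has_comeager_orbit : Prop := exists x : X, comeager (orbit x).

Definition G_ED : Prop :=
  forall (A : set X) (U : set G), open A -> nbhs (1%g : G) U ->
    closure A `<=` interior (closure (setact U A)).

Definition sym_open_nbhs1 (U : set G) : Prop :=
  open_nbhs (1%g : G) U /\ symmetric_set U.

Definition U_TT (U : set G) (A : set X) : Prop :=
  [/\ open A, A !=set0 &
      forall B : set X, open B -> B !=set0 -> B `<=` A ->
        A `<=` closure (setact U B)].

Definition rosendal : Prop :=
  forall U : set G, sym_open_nbhs1 U ->
  forall A : set X, open A -> A !=set0 ->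
  exists2 B : set X, U_TT U B & B `<=` A.

Definition Q_ (U : set G) (x : X) : set X :=
  \bigcap_(A in [set A : set X | open A /\ closure A x]) closure (setact U A).

Definition G_isolated (x : X) : Prop :=
  forall U : set G, sym_open_nbhs1 U -> interior (Q_ U x) x.

End Flows.

Definition flow_iso (G : topGroupType) (X Y : gflow G) : Prop :=
  exists (f : X -> Y) (g : Y -> X),
    [/\ gmap f, gmap g, cancel f g & cancel g f].

Arguments minimal_flow {G} X.
Arguments has_comeager_orbit {G} X.
Arguments G_ED {G} X.
Arguments rosendal {G} X.

Section PartialD.
Variables (R : realType) (G : topGroupType) (d : G -> G -> R) (X : gflow G).

Definition Bd (c : R) : set G := [set g | d g 1%g < c].

Definition partial_le (x y : X) (c : R) : Prop :=
  forall e : R, 0 < e -> forall A : set X, open A -> A x ->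
    closure (setact (Bd (c + e)) A) y.

(* The value is +oo when [partial_le x y c] holds for no c; the infimum is
   attained otherwise, see [partial_dP]. *)
Definition partial_d (x y : X) : \bar R :=
  ereal_inf [set c%:E | c in [set c : R | 0 <= c /\ partial_le x y c]].

Lemma partial_dP (x y : X) (c : R) : 0 <= c ->
  (partial_d x y <= c%:E)%E <-> partial_le x y c.
Proof.
move=> c0; split=> [pxy e e0 A oA Ax|pxy]; last first.
  by apply: ereal_inf_lbound; exists c.
have : (partial_d x y < (c + e / 2)%:E)%E.
  by rewrite (le_lt_trans pxy)// lte_fin ltrDl divr_gt0.
move=> /ereal_inf_lt[_ [b [b0 pb] <-]]; rewrite lte_fin => bce.
have := pb (c + e - b); rewrite subrKC; apply => //.
rewrite subr_gt0 (lt_trans bce)// ltrD2l ltr_pdivrMr// ltr_pMr//.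
by rewrite ltr1n.
Qed.

Definition partial_compatible (x : X) : Prop :=
  forall c : R, 0 < c ->
    interior [set z : X | (partial_d x z < c%:E)%E] x.

End PartialD.

Definition universal_minimal_flow (G : topGroupType) (M : gflow G) : Prop :=
  minimal_flow M /\
  forall Y : gflow G, minimal_flow Y ->
    exists f : M -> Y, gmap f /\ range f = [set: Y].

(* [universal_minimal_flow] determines M up to isomorphism, so M below is
   the universal minimal flow of G. *)
Definition TMD (G : topGroupType) : Prop :=
  hausdorff_space G /\
  exists M : gflow G, universal_minimal_flow M /\ rosendal M.

Definition GPP (R : realType) (G : topGroupType) : Prop :=
  polish R G /\ forall X : gflow G, minimal_flow X -> has_comeager_orbit X.

Section CosetSpace.
Variable G : topGroupType.
Implicit Types (g h : G) (A H : set G).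

Definition ltrans g A : set G := [set (g * a)%g | a in A].

Lemma ltrans1 A : ltrans 1%g A = A.
Proof.
by apply/seteqP; split=> [_ [a Aa <-]|a Aa]; rewrite ?mul1g//; exists a;
  rewrite ?mul1g.
Qed.

Lemma ltransM g h A : ltrans (g * h)%g A = ltrans g (ltrans h A).
Proof.
apply/seteqP; split=> [_ [a Aa <-]|_ [_ [a Aa <-] <-]].
  by exists (h * a)%g; rewrite ?mulgA//; exists a.
by exists a; rewrite ?mulgA.
Qed.

(* When H is a subgroup this is G/H, as a set of left cosets. None of the
   constructions below needs H to be a subgroup. *)
Definition coset_space H : Type := set_type (range (fun g => ltrans g H)).

HB.instance Definition _ H := Choice.on (coset_space H).

Variable H : set G.

Lemma coset_act_subproof g (C : coset_space H) :
  ltrans g (val C) \in range (fun k => ltrans k H).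
Proof.
rewrite inE; case: C => C /= /set_mem[k _ <-].
by exists (g * k)%g => //; rewrite ltransM.
Qed.

Definition coset_act g (C : coset_space H) : coset_space H :=
  exist _ (ltrans g (val C)) (coset_act_subproof g C).

Lemma coset_act1 C : coset_act 1%g C = C.
Proof. by apply/val_inj; rewrite /= ltrans1. Qed.

Lemma coset_actM g h C : coset_act (g * h)%g C = coset_act g (coset_act h C).
Proof. by apply/val_inj; rewrite /= ltransM. Qed.

(* C = gH and D = kH are related when gH belongs to U k H. *)
Definition coset_rel (U : set G) : set (coset_space H * coset_space H) :=
  [set CD | exists2 u, U u & CD.1 = coset_act u CD.2].

Definition coset_ent : set_system (coset_space H * coset_space H) :=
  filter_from (nbhs (1%g : G)) coset_rel.

Lemma coset_ent_filter : Filter coset_ent.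
Proof.
apply: filter_from_filter; first by exists setT; exact: filterT.
move=> U V nU nV; exists (U `&` V); first exact: filterI.
by move=> CD [u [Uu Vu] CDE]; split; exists u.
Qed.

Lemma coset_ent_diagonal E : coset_ent E -> diagonal `<=` E.
Proof.
move=> [U nU UE] [C D] /= CD; apply: UE; exists 1%g.
  exact: nbhs_singleton nU.
by rewrite /= coset_act1; exact: CD.
Qed.

Lemma coset_ent_inv E : coset_ent E -> coset_ent (E^-1)%relation.
Proof.
move=> [U nU UE]; exists [set x | U (x^-1)%g].
  by apply: (@invg_continuous G 1%g); rewrite /= invg1.
move=> [C D] [u Uu /= ->]; apply: UE; exists (u^-1)%g => //=.
by rewrite -coset_actM mulVg coset_act1.
Qed.

Lemma coset_ent_split E : coset_ent E ->
  exists2 B, coset_ent B & (B \; B)%relation `<=` E.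
Proof.
move=> [U nU UE].
have : nbhs ((1%g : G), (1%g : G)) [set p | U (p.1 * p.2)%g].
  by apply: (@mulg_continuous G (1%g, 1%g)); rewrite /= mulg1.
move=> [[P Q] /= [nP nQ] PQ]; exists (coset_rel (P `&` Q)).
  by exists (P `&` Q) => //; exact: filterI.
move=> [C D] [K [p [Pp Qp] /= CK] [q [Pq Qq] /= KD]]; apply: UE.
exists (p * q)%g; first exact: (PQ (p, q)).
by rewrite /= coset_actM -KD.
Qed.

HB.instance Definition _ := isUniform.Build (coset_space H)
  coset_ent_filter coset_ent_diagonal coset_ent_inv coset_ent_split.

End CosetSpace.

Section BUC.
Variables (R : realType) (T : uniformType).
Local Notation fT := (T -> R^o).

Definition buc_pred : {pred fT} :=
  fun f => `[< unif_continuous f /\ bounded_fun f >].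

Lemma buc_predP (f : fT) :
  reflect ((forall e : R, 0 < e -> exists2 E, entourage E &
              forall x y, E (x, y) -> `|f x - f y| < e) /\
           exists M : R, forall x, `|f x| <= M)
    (f \in buc_pred).
Proof.
apply: (iffP idP) => [/asboolP[uf bf]|[uf [M bf]]].
  split; last first.
    have [M [_ fM]] := bf; exists (M + 1) => x.
    by apply: fM => //; rewrite ltrDl.
  move=> e e0.
  have /uf : entourage [set xy : R^o * R^o | ball xy.1 e xy.2].
    exact: (@entourage_ball _ _ (PosNum e0)).
  by rewrite /= nbhs_simpl /= => eE; eexists; [exact: eE|move=> x y; exact].
apply/asboolP; split.
  move=> E; rewrite -entourage_ballE => -[e /= e0 eE].
  have [E' entE' E'e] := uf _ e0; rewrite /= nbhs_simpl /=.
  apply: filterS entE' => -[x y] /E'e xy; exact: eE.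
exists M; split; first exact: num_real.
by move=> N MN x _; apply: le_trans (bf x) (ltW MN).
Qed.

Lemma buc_cst (c : R) : (cst c : fT) \in buc_pred.
Proof.
apply/buc_predP; split; last by exists `|c|.
by move=> e e0; exists setT; [exact: entourageT|move=> x y _; rewrite subrr normr0].
Qed.


Lemma buc_sub (f g : fT) : f \in buc_pred -> g \in buc_pred ->
  f - g \in buc_pred.
Proof.
move=> /buc_predP[uf [M fM]] /buc_predP[ug [N gN]]; apply/buc_predP; split.
  move=> e e0; have e20 : 0 < e / 2 by rewrite divr_gt0.
  have [E entE fE] := uf _ e20; have [F entF gF] := ug _ e20.
  exists (E `&` F); first exact: filterI.
  move=> x y [/fE fxy /gF gxy].
  have -> : (f - g) x - (f - g) y = (f x - f y) - (g x - g y).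
    by rewrite !fctE !opprB addrACA [RHS]addrACA; congr (_ + _); rewrite addrC.
  by rewrite [e]splitr (le_lt_trans (ler_normB _ _))// ltrD.
by exists (M + N) => x; apply: le_trans (ler_normB _ _) (lerD (fM x) (gN x)).
Qed.

Lemma buc_mul (f g : fT) : f \in buc_pred -> g \in buc_pred ->
  (f * g : T -> R) \in buc_pred.
Proof.
move=> /buc_predP[uf [M fM]] /buc_predP[ug [N gN]]; apply/buc_predP; split.
  move=> e e0; pose K := `|M| + `|N|.
  have K0 : 0 <= K by rewrite addr_ge0.
  have fK x : `|f x| <= K.
    by rewrite (le_trans (fM x))// (le_trans (ler_norm M))// lerDl.
  have gK x : `|g x| <= K.
    by rewrite (le_trans (gN x))// (le_trans (ler_norm N))// lerDr.
  pose D := e / (2 * K + 1).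
  have D0 : 0 < D by rewrite divr_gt0// ltr_wpDl// mulr_ge0.
  have eE : e = (2 * K + 1) * D.
    by rewrite mulrCA divff ?mulr1// gt_eqF// ltr_wpDl// mulr_ge0.
  have [E entE fE] := uf _ D0; have [F entF gF] := ug _ D0.
  exists (E `&` F); first exact: filterI.
  move=> x y [/fE fxy /gF gxy].
  have -> : (f * g : T -> R) x - (f * g : T -> R) y =
      f x * (g x - g y) + (f x - f y) * g y.
    by rewrite mulrBr mulrBl addrA subrK.
  rewrite (le_lt_trans (ler_normD _ _))// !normrM eE.
  have h1 : `|f x| * `|g x - g y| <= K * D by rewrite ler_pM// ltW.
  have h2 : `|f x - f y| * `|g y| <= D * K by rewrite ler_pM// ltW.
  rewrite (le_lt_trans (lerD h1 h2))// [(2 * K + 1) * D]mulrDl mul1r [D * K]mulrC.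
  by rewrite -(mulrA 2) mulr_natl mulr2n ltrDl.
exists (M * N) => x; rewrite normrM.
by apply: ler_pM.
Qed.

Lemma buc_subring_closed : subring_closed (buc_pred : {pred T -> R}).
Proof. by split; [exact: buc_cst|exact: buc_sub|exact: buc_mul]. Qed.

Lemma buc_submod_closed : submod_closed buc_pred.
Proof.
have b0 : (0 : fT) \in buc_pred by exact: (buc_cst 0).
split=> // a f g fB gB.
have -> : a *: f + g = g - (0 - (cst a * f : T -> R)).
  by rewrite sub0r opprK addrC.
by rewrite buc_sub// buc_sub// buc_mul// buc_cst.
Qed.

Record buc : Type := BUC { buc_val : T -> R^o; bucP : buc_val \in buc_pred }.

HB.instance Definition _ := [isSub for buc_val].
HB.instance Definition _ := [Choice of buc by <:].
HB.instance Definition _ :=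
  GRing.SubChoice_isSubComPzRing.Build (T -> R^o) buc_pred buc
    buc_subring_closed.
HB.instance Definition _ :=
  GRing.SubZmodule_isSubLmodule.Build R (T -> R^o) buc_pred buc
    buc_submod_closed.
End BUC.

Section Samuel.
Variables (R : realType) (T : uniformType).
Local Notation bT := (buc R T).

(* For real scalars, the Gelfand dual of the algebra of bounded uniformly
   continuous functions consists of its unital algebra morphisms to R, with the
   topology of pointwise convergence. *)
Definition gelfand_dual : set {ptws bT -> R^o} :=
  [set phi : bT -> R^o | scalar phi /\ monoid_morphism phi].

Definition samuel : Type := set_type gelfand_dual.

HB.instance Definition _ := Topological.on samuel.

Definition sa_of (phi : {ptws bT -> R^o}) (phiP : gelfand_dual phi) : samuel :=
  exist _ phi (mem_set phiP).

Definition sa_eval (phi : samuel) : bT -> R^o := val phi.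

Lemma sa_evalP (phi : samuel) : gelfand_dual (sa_eval phi).
Proof. by case: phi => phi p; exact: set_mem p. Qed.

Lemma sa_eval_inj : injective sa_eval.
Proof. by move=> f g fg; apply/val_inj. Qed.

Lemma sa_eval_cvg (F : set_system samuel) (phi : samuel) : Filter F ->
  (forall f, (fun psi => sa_eval psi f) @ F --> sa_eval phi f) -> F --> phi.
Proof.
move=> FF Fphi U.
have Fv : val @ F --> (val phi : {ptws bT -> R^o}).
  apply/cvg_sup => f A [B [[V oV <-]] Vphi BA].
  have := Fphi f V (open_nbhs_nbhs (conj oV Vphi)).
  by rewrite !nbhs_simpl /=; apply: filterS => psi; exact: BA.
move=> [B [[W oW <-]] Wphi BU].
have := Fv W (open_nbhs_nbhs (conj oW Wphi)).
by rewrite !nbhs_simpl /=; apply: filterS => psi; exact: BU.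
Qed.

Lemma sa_eval_continuous (f : bT) :
  continuous (fun phi : samuel => sa_eval phi f).
Proof.
move=> phi; apply: (@continuous_comp samuel {ptws bT -> R^o} R^o val (@^~ f)).
  exact: initial_continuous.
exact: (@proj_continuous bT (fun=> R^o) f).
Qed.

Lemma sa_hausdorff : hausdorff_space samuel.
Proof.
move=> p q pq; apply: sa_eval_inj; apply/funext => f.
apply: (@norm_hausdorff R R^o) => A B nA nB.
have [r [Ar Br]] := pq _ _ (sa_eval_continuous nA) (sa_eval_continuous nB).
by exists (sa_eval r f).
Qed.

Lemma buc_sqrt (f : bT) : (fun x => Num.sqrt (buc_val f x) : R^o) \in @buc_pred R T.
Proof.
have /buc_predP[uf [M fM]] := bucP f; apply/buc_predP; split.
  move=> e e0; have [E entE fE] := uf _ (exprn_gt0 2 e0).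
  exists E => // x y /fE.
  set a := buc_val f x; set b := buc_val f y.
  have key (s t : R) : `|Num.sqrt s - Num.sqrt t| ^+ 2 <= `|s - t|.
    wlog st : s t / s <= t.
      by move=> h; have [/h//|/ltW/h] := leP s t; rewrite distrC [X in _ <= X]distrC.
    rewrite distrC [X in _ <= X]distrC.
    rewrite (ger0_norm (_ : 0 <= t - s)) ?subr_ge0//.
    rewrite ger0_norm ?subr_ge0 ?ler_wsqrtr//.
    have [s0|s0] := leP s 0.
      rewrite (ler0_sqrtr s0) subr0; have [t0|t0] := leP t 0.
        by rewrite ler0_sqrtr// expr0n subr_ge0.
      by rewrite (sqr_sqrtr (ltW t0)) lerDl oppr_ge0.
    have t0 := lt_le_trans s0 st.
    rewrite -[X in _ <= X - _](sqr_sqrtr (ltW t0)).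
    rewrite -[X in _ <= _ - X](sqr_sqrtr (ltW s0)) subr_sqr expr2.
    rewrite ler_wpM2l ?subr_ge0 ?ler_wsqrtr// lerD2l.
    by rewrite ge0_cp// sqrtr_ge0.
  move=> abe.
  have nn : `|Num.sqrt a - Num.sqrt b| \is Num.nneg by rewrite nnegrE.
  have ne : e \is Num.nneg by rewrite nnegrE ltW.
  by rewrite -(ltr_pXn2r (isT : (0 < 2)%N) nn ne) (le_lt_trans (key _ _)).
exists (Num.sqrt `|M|) => x; rewrite ger0_norm ?sqrtr_ge0// ler_wsqrtr//.
by rewrite (le_trans (ler_norm _))// (le_trans (fM x))// ler_norm.
Qed.

Lemma sa_evalB (phi : samuel) (f g : bT) :
  sa_eval phi (f - g) = sa_eval phi f - sa_eval phi g.
Proof.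
have [lphi _] := sa_evalP phi.
by rewrite addrC -scaleN1r lphi mulN1r addrC.
Qed.

Lemma sa_eval_cst (phi : samuel) (a : R) : sa_eval phi (a *: (1 : bT)) = a.
Proof.
have [lphi [phi1 _]] := sa_evalP phi.
have phi0 : sa_eval phi 0 = 0 by rewrite -[X in sa_eval _ X](subrr 0) sa_evalB subrr.
by rewrite -[_ *: _]addr0 lphi phi0 addr0 phi1 mulr1.
Qed.

Lemma sa_eval_le (phi : samuel) (f : bT) (M : R) :
  (forall x, buc_val f x <= M) -> sa_eval phi f <= M.
Proof.
move=> fM; have [_ [_ phiM]] := sa_evalP phi.
pose h : bT := M *: (1 : bT) - f; pose k := BUC (buc_sqrt h).
have hk : h = k * k.
  apply/val_inj/funext => x; rewrite -[RHS]expr2 sqr_sqrtr//.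
  have -> : buc_val h x = M * 1 - buc_val f x by [].
  by rewrite mulr1 subr_ge0.
by rewrite -subr_ge0 -(sa_eval_cst phi M) -sa_evalB -/h hk phiM -expr2 sqr_ge0.
Qed.

Lemma sa_eval_norm (phi : samuel) (f : bT) (M : R) :
  (forall x, `|buc_val f x| <= M) -> `|sa_eval phi f| <= M.
Proof.
move=> fM; rewrite ler_norml; apply/andP; split; last first.
  by apply: sa_eval_le => x; rewrite (le_trans (ler_norm _)).
have -> : sa_eval phi f = - sa_eval phi (0 *: (1 : bT) - f).
  by rewrite sa_evalB sa_eval_cst sub0r opprK.
rewrite lerN2; apply: sa_eval_le => x.
have -> : buc_val (0 *: (1 : bT) - f) x = 0 * 1 - buc_val f x by [].
by rewrite mul0r sub0r (le_trans (ler_norm _))// normrN.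
Qed.

Let closed_eqfun (X : topologicalType) (h k : X -> R^o) :
  continuous h -> continuous k -> closed [set x | h x = k x].
Proof.
move=> ch ck; have -> : [set x | h x = k x] = (h \- k) @^-1` [set y : R^o | y = 0].
  by apply/seteqP; split=> x /= => [->|/eqP]; rewrite ?subrr// subr_eq0 => /eqP.
apply: preimage_closed; last exact: (@closed_eq R 0).
by move=> x _; apply: cvgB; [exact: ch|exact: ck].
Qed.

Let continuous_lin (X : topologicalType) (a : R) (h k : X -> R^o) :
  continuous h -> continuous k -> continuous (fun x => a * h x + k x : R^o).
Proof.
by move=> ch ck x; apply: cvgD; [apply: cvgMr; exact: ch|exact: ck].
Qed.

Let continuous_mul (X : topologicalType) (h k : X -> R^o) :
  continuous h -> continuous k -> continuous (fun x => h x * k x : R^o).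
Proof. by move=> ch ck x; apply: cvgM; [exact: ch|exact: ck]. Qed.

Lemma closed_gelfand_dual : closed gelfand_dual.
Proof.
have evc (f : bT) : continuous (fun phi : {ptws bT -> R^o} => phi f : R^o).
  exact: (@proj_continuous bT (fun=> R^o) f).
pose P := {ptws bT -> R^o}.
pose Lin (a : R) (f g : bT) : set P :=
  [set phi | (phi (a *: f + g) : R^o) = a * phi f + phi g].
pose Mul (f g : bT) : set P := [set phi | (phi (f * g) : R^o) = phi f * phi g].
pose One : set P := [set phi | (phi 1 : R^o) = 1].
have cLin a f g : closed (Lin a f g).
  exact: (@closed_eqfun P _ _ (evc _) (@continuous_lin P a _ _ (evc f) (evc g))).
have cMul f g : closed (Mul f g).
  exact: (@closed_eqfun P _ _ (evc _) (@continuous_mul P _ _ (evc f) (evc g))).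
have cOne : closed One.
  exact: (@closed_eqfun P _ _ (evc 1) (@cst_continuous P R^o 1)).
have -> : gelfand_dual =
    (\bigcap_a \bigcap_f \bigcap_g Lin a f g) `&`
    (One `&` \bigcap_f \bigcap_g Mul f g).
  apply/seteqP; split=> [phi [l [p1 pM]]|phi [l [p1 pM]]].
    split; first by move=> a _ f _ g _; exact: l.
    by split; [exact: p1|move=> f _ g _; exact: pM].
  split; first by move=> a f g; exact: (l a I f I g I).
  by split; [exact: p1|move=> f g; exact: (pM f I g I)].
apply: closedI; last apply: closedI.
- by do 3![apply: closed_bigI => ? _]; exact: cLin.
- exact: cOne.
- by do 2![apply: closed_bigI => ? _]; exact: cMul.
Qed.

Lemma gelfand_dual_compact : compact gelfand_dual.
Proof.
pose bd (f : bT) : R := xget 0 [set M : R | forall x, `|buc_val f x| <= M].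
have bdP f x : `|buc_val f x| <= bd f.
  rewrite /bd; case: xgetP => [M _ /= //|nM].
  by have /buc_predP[_ [M fM]] := bucP f; case: (nM M).
pose B : set {ptws bT -> R^o} := [set phi | forall f, `[- bd f, bd f]%classic (phi f)].
have cB : compact B.
  apply: (@tychonoff bT (fun=> R^o) (fun f => `[- bd f, bd f]%classic)) => f.
  exact: segment_compact.
apply: (subclosed_compact closed_gelfand_dual cB) => phi gphi f.
have := @sa_eval_norm (sa_of gphi) f _ (bdP f).
by rewrite /= in_itv /= ler_norml.
Qed.

Lemma sa_compact : compact [set: samuel].
Proof.
move=> F FF _.
have FvF : ProperFilter (val @ F) by exact: fmap_proper_filter.
have vF : (val @ F) gelfand_dual.
  by rewrite /= nbhs_simpl /=; apply: filterE => phi; exact: sa_evalP.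
have [phi [gphi clphi]] := gelfand_dual_compact FvF vF.
exists (sa_of gphi); split=> //.
move=> A B FA [C [[W oW <-]] Wphi CB].
have FAi : (val @ F) (val @` A).
  by rewrite /= nbhs_simpl /=; apply: filterS FA => psi Apsi; exists psi.
have [_ [[psi Apsi <-] Wpsi]] := clphi _ _ FAi (open_nbhs_nbhs (conj oW Wphi)).
by exists psi; split=> //; exact: CB.
Qed.

End Samuel.

Arguments gelfand_dual : clear implicits.

Section SamuelFlow.
Variables (R : realType) (G : topGroupType) (H : set G).
Local Notation GH := (coset_space H).
Local Notation bT := (buc R GH).

Let continuous_mulg (X : topologicalType) (h k : X -> G) :
  continuous h -> continuous k -> continuous (fun x => (h x * k x)%g).
Proof.
move=> ch ck x.
exact: (cvg_comp _ _ (cvg_pair (ch x) (ck x)) (@mulg_continuous G (h x, k x))).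
Qed.

Lemma buc_ltrans_subproof (g : G) (f : bT) :
  (fun C => buc_val f (coset_act g C)) \in @buc_pred R GH.
Proof.
have /buc_predP[uf [M fM]] := bucP f; apply/buc_predP; split; last by exists M.
move=> e e0; have [E [U nU UE] Ef] := uf _ e0.
exists (coset_rel (H := H) [set u | U (g * u * g^-1)%g]); last first.
  move=> C D [u Uu /= ->]; apply: Ef; apply: UE; exists (g * u * g^-1)%g => //=.
  by rewrite -!coset_actM mulgVK.
exists [set u | U (g * u * g^-1)%g] => //.
have cconj : continuous (fun u : G => (g * u * g^-1)%g).
  by apply: continuous_mulg; [apply: continuous_mulg|]; move=> u;
    [exact: cvg_cst|exact: cvg_id|exact: cvg_cst].
by apply: (cconj 1%g); rewrite /= mulg1 mulgV.
Qed.

Definition buc_ltrans (g : G) (f : bT) : bT := BUC (buc_ltrans_subproof g f).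

Lemma sa_act_subproof (g : G) (phi : samuel R GH) :
  gelfand_dual R GH (fun f : bT => sa_eval phi (buc_ltrans g f)).
Proof.
have [lphi [phi1 phiM]] := sa_evalP phi; split.
  move=> a f h; rewrite -lphi; congr (sa_eval phi _).
  exact/val_inj.
by split=> [|f h]; [rewrite -phi1|rewrite -phiM]; congr (sa_eval phi _);
  exact/val_inj.
Qed.

(* This action extends left translation on G/H: the evaluation at C is sent to
   the evaluation at g C, see [sa_act_point]. *)
Definition sa_act (g : G) (phi : samuel R GH) : samuel R GH :=
  sa_of (sa_act_subproof g phi).

Lemma sa_act1 phi : sa_act 1%g phi = phi.
Proof.
apply: sa_eval_inj; apply/funext => f; congr (sa_eval phi _).
by apply/val_inj/funext => C /=; rewrite coset_act1.
Qed.

Lemma sa_actM g h phi : sa_act (g * h)%g phi = sa_act g (sa_act h phi).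
Proof.
apply: sa_eval_inj; apply/funext => f; congr (sa_eval phi _).
by apply/val_inj/funext => C /=; rewrite coset_actM.
Qed.

Lemma sa_act_continuous :
  continuous (fun p : G * samuel R GH => sa_act p.1 p.2).
Proof.
move=> [g0 phi0]; apply: sa_eval_cvg => f /=.
apply/cvgrPdist_lt => e e0; have e20 : 0 < e / 2 by rewrite divr_gt0.
have /buc_predP[uf _] := bucP f; have [E [U nU UE] Ef] := uf _ e20.
have nU0 : nbhs g0 [set g | U (g * g0^-1)%g].
  have c : continuous (fun u : G => (u * g0^-1)%g).
    by apply: continuous_mulg => u; [exact: cvg_id|exact: cvg_cst].
  by apply: (c g0); rewrite /= mulgV.
have nphi : nbhs phi0 [set phi | `|sa_eval phi0 (buc_ltrans g0 f) -
                                 sa_eval phi (buc_ltrans g0 f)| < e / 2].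
  have /cvgrPdist_lt := @sa_eval_continuous R GH (buc_ltrans g0 f) phi0.
  exact.
exists ([set g | U (g * g0^-1)%g], [set phi | `|sa_eval phi0 (buc_ltrans g0 f) -
                                 sa_eval phi (buc_ltrans g0 f)| < e / 2]) => //.
move=> [g phi] /= [Ug phie]; rewrite [e]splitr.
have -> : sa_eval phi0 (buc_ltrans g0 f) - sa_eval (sa_act g phi) f =
    (sa_eval phi0 (buc_ltrans g0 f) - sa_eval phi (buc_ltrans g0 f)) -
    sa_eval phi (buc_ltrans g f - buc_ltrans g0 f).
  rewrite sa_evalB opprB addrA subrK; congr (_ - _).
rewrite (le_lt_trans (ler_normB _ _))// ltr_leD//.
apply: sa_eval_norm => C; apply/ltW/Ef/UE; exists (g * g0^-1)%g => //=.
by rewrite -coset_actM mulgVK.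
Qed.

Lemma sa_point_subproof (C : GH) :
  gelfand_dual R GH (fun f : bT => buc_val f C).
Proof. by []. Qed.

Definition sa_point (C : GH) : samuel R GH := sa_of (sa_point_subproof C).

Lemma sa_act_point g C : sa_act g (sa_point C) = sa_point (coset_act g C).
Proof. exact/val_inj. Qed.

Definition Sa : gflow G :=
  GFlow sa_act1 sa_actM sa_act_continuous (@sa_compact R GH)
    (@sa_hausdorff R GH).

End SamuelFlow.

(* Main.v *)
Require Import Defs.
From HB Require Import structures.
From mathcomp Require Import all_boot all_order all_algebra.
From mathcomp Require Import all_classical all_reals.
From mathcomp Require Import ereal topology normedtype sequences.
From mathcomp Require Import lra.

(** The six conditions are compared through one property of a point x: its orbit
    is locally dense, meaning that x is interior to the closure of U x for every
    neighbourhood U of the identity.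

    For a Polish group, a locally dense and dense orbit is comeager: this is the
    open mapping argument [locally_dense_orbit_meager]. Conversely, a point with
    comeager orbit has a locally dense orbit, by the Baire property. A locally
    dense orbit makes x lie in U-TT sets for all U, which gives the Rosendal criterion by minimality and,
    by regularity of X and joint continuity of the action, first countability
    at x.

    In the other direction, the Rosendal criterion gives by Baire category a point
    lying in U-TT sets for all U, hence a point of first countability; translating
    its base by a countable dense subset of G gives a countable pi-base of X, and
    with it the generic point of X has a locally dense orbit
    ([rosendal_exists_locally_dense]).

    The G-ED property enters as a separation principle, [G_ED_separation]: open
    sets that stay apart under small motions have disjoint closures. It shows that
    points of first countability are G-isolated, by an argument on sequences with
    even and odd terms. G-isolated points are compatible with the pseudometric of
    any right-invariant metric almost by definition, and compatible points lie in
    U-TT sets; that a right-invariant metric exists is [birkhoff_kakutani].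

    Finally, if x has a locally dense orbit and H is its stabilizer, the orbit map
    identifies G/H with the orbit of x as a topological space, so H is
    presyndetic, and there is a canonical map from Sa(G/H) onto X. The separation
    principle makes bounded uniformly continuous functions on G/H extend
    continuously to X, so this map is injective
    ([locally_dense_orbit_samuel]). Conversely, in Sa(G/H) the base point has a
    locally dense orbit ([sa_point_locally_dense]).

    For the last assertion, the passage from the Rosendal criterion to a locally
    dense orbit applies to M(G), and locally dense orbits pass to factors
    ([locally_dense_orbit_factor]). The universal minimal flow itself is obtained
    as a minimal subflow of Sa(G). *)

Set Implicit Arguments.
Unset Strict Implicit.
Unset Printing Implicit Defensive.

Import Order.TTheory GRing.Theory Num.Theory.
Import numFieldNormedType.Exports.

Local Open Scope classical_set_scope.
Local Open Scope ring_scope.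

(** * Compact Hausdorff spaces and the Baire property *)

Section Topology.
Variable X : topologicalType.
Implicit Types (A B O V : set X) (x y : X).

Lemma closure_meets_open A O x : closure A x -> open O -> O x ->
  exists2 y, A y & O y.
Proof.
move=> Ax oO Ox; have [y [Ay Oy]] := Ax O (open_nbhs_nbhs (conj oO Ox)).
by exists y.
Qed.

Lemma closure_of_open_meets A x :
  (forall O, open O -> O x -> exists2 y, A y & O y) -> closure A x.
Proof.
move=> h B; rewrite nbhsE => -[O [oO Ox] OB].
by have [y Ay Oy] := h O oO Ox; exists y; split=> //; exact: OB.
Qed.

Lemma interior_mem_open O A x : open O -> O x -> O `<=` A -> interior A x.
Proof. by move=> oO Ox OA; apply: (filterS OA); exact: open_nbhs_nbhs. Qed.

Lemma dense_meets_open A O x : dense A -> open O -> O x -> exists2 y, A y & O y.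
Proof.
by move=> dA oO Ox; have [y [Oy Ay]] := dA O (ex_intro _ x Ox) oO; exists y.
Qed.

(** The boundary of an open set is nowhere dense. In the Baire category arguments
    below, the exceptional sets of a generic point have this shape. *)
Lemma nowhere_dense_open_diff O V : open O -> open V -> O `<=` closure V ->
  nowhere_dense (O `\` V).
Proof.
move=> oO oV OV; apply/seteqP; split=> // x Ix.
have oI := @open_interior X (closure (O `\` V)).
have [y [Oy _] Iy] := closure_meets_open (interior_subset Ix) oI Ix.
have [z Vz [Oz Iz]] := closure_meets_open (OV _ Oy) (openI oO oI) (conj Oy Iy).
have [w [_ nVw] Vw] := closure_meets_open (interior_subset Iz) oV Vz.
exact: nVw.
Qed.

Lemma nowhere_dense_subset A B : A `<=` B -> nowhere_dense B -> nowhere_dense A.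
Proof.
move=> AB nB; apply/seteqP; split=> // x Ix; rewrite -nB.
by apply: filterS Ix; exact: closureS.
Qed.

Hypotheses (cX : compact [set: X]) (hX : hausdorff_space X).

Lemma compact_hausdorff_shrink x O : open O -> O x ->
  exists V, [/\ open V, V x & closure V `<=` O].
Proof.
move=> oO Ox; have nO : nbhs x O by exact: open_nbhs_nbhs.
have [B nB BO] := compact_regular hX cX (filterT : nbhs x setT) nO.
exists (interior B); split; [exact: open_interior|exact: nB|].
exact: subset_trans (closureS (@interior_subset _ B)) BO.
Qed.

Lemma compact_decreasing_closure (V : nat -> set X) :
  (forall n, V n !=set0) -> (forall n, closure (V n.+1) `<=` V n) ->
  exists x, forall n, V n x.
Proof.
move=> V0 VS.
have Vle m n : (m <= n)%N -> V n `<=` V m.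
  elim: n => [|n IH]; first by rewrite leqn0 => /eqP ->.
  rewrite leq_eqVlt => /orP[/eqP ->//|/IH h].
  apply: subset_trans h; apply: subset_trans (VS n); exact: subset_closure.
have FF : ProperFilter (filter_from [set: nat] V).
  apply: filter_from_proper => //; apply: filter_from_filter; first by exists 0%N.
  move=> m n _ _; exists (maxn m n) => // x Vx.
  by split; apply: Vle Vx; rewrite ?leq_maxl ?leq_maxr.
have [x [_ xV]] := cX FF (filterT : filter_from [set: nat] V setT).
exists x => n; apply: VS => B nB; apply: xV => //; by exists n.+1.
Qed.

(** The finite sets of indices, directed by inclusion, form the filter along
    which compactness is used. *)
Lemma compact_finite_subcover (I : Type) (f : I -> set X) :
  (forall i, open (f i)) -> (forall x, exists i, f i x) ->
  exists2 D : set I, finite_set D & forall x, exists2 i, D i & f i x.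
Proof.
move=> fo fc.
pose F := filter_from (@finite_set I) (fun D => [set E | D `<=` E]).
have FF : Filter F.
  apply: filter_from_filter; first by exists set0.
  move=> D E fD fE; exists (D `|` E); first by rewrite finite_setU.
  by move=> K DEK; split=> i ?; apply: DEK; [left|right].
have /compact_near_coveringP cov := cX.
have := cov _ F (fun D x => exists2 i, D i & f i x) FF.
case.
  move=> x _; have [i fix_] := fc x.
  exists (f i, [set E | [set i] `<=` E]) => /=.
    split; first exact: open_nbhs_nbhs.
    by exists [set i].
  by move=> [y E] /= [fy iE]; exists i => //; exact: iE.
move=> D fD Dsub; exists D => // x; exact: (Dsub D).
Qed.

(** Nested nonempty open sets, the closure of each avoiding one more of the
    nowhere dense sets, have a common point by compactness. *)
Lemma compact_baire (F : nat -> set X) O : (forall n, nowhere_dense (F n)) ->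
  open O -> O !=set0 -> exists2 x, O x & forall n, ~ F n x.
Proof.
move=> nF oO O0.
pose T := {V : set X | open V /\ V !=set0}.
have step (n : nat) (V : T) :
    {W : T | closure (sval W) `<=` sval V `\` closure (F n)}.
  apply: cid; case: V => V [oV [v Vv]] /=.
  have [x [Vx nx]] : (V `\` closure (F n)) !=set0.
    apply: contrapT => h.
    have : interior (closure (F n)) v.
      apply: (interior_mem_open oV Vv) => x Vx; apply: contrapT => nx; apply: h.
      by exists x.
    by rewrite nF.
  have oVF : open (V `\` closure (F n)).
    by apply: openI => //; rewrite openC; exact: closed_closure.
  have [W [oW Wx WV]] := compact_hausdorff_shrink oVF (conj Vx nx).
  by exists (exist _ W (conj oW (ex_intro _ x Wx))).
pose V := fix V n : T := if n is m.+1 then sval (step m (V m))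
  else exist _ O (conj oO O0).
have VP n : closure (sval (V n.+1)) `<=` sval (V n) `\` closure (F n).
  exact: (svalP (step n (V n))).
have [n|n|x Vx] := @compact_decreasing_closure (fun n => sval (V n)).
- by case: (V n) => W [].
- by move=> y /VP[].
exists x; first exact: (Vx 0%N).
move=> n Fx; have [|_] := VP n x; first exact/subset_closure/Vx.
by apply; exact: subset_closure.
Qed.

End Topology.

Lemma compact_baire_countable (X : topologicalType) (I : countType)
    (F : I -> set X) (O : set X) : compact [set: X] -> hausdorff_space X ->
  (forall i, nowhere_dense (F i)) -> open O -> O !=set0 ->
  exists2 x, O x & forall i, ~ F i x.
Proof.
move=> cX hX nF oO O0.
pose F' n := if unpickle n is Some i then F i else set0.
have [n|x Ox xF'] := compact_baire cX hX (F := F') _ oO O0.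
  rewrite /F'; case: (unpickle n) => // .
  rewrite /nowhere_dense closure0; apply/seteqP; split=> // x.
  exact: interior_subset.
by exists x => // i; have := xF' (pickle i); rewrite /F' pickleK.
Qed.

Lemma meager_countable_cover (X : topologicalType) (I : countType)
    (F : I -> set X) (A : set X) :
  (forall i, nowhere_dense (F i)) -> A `<=` \bigcup_i F i -> meager A.
Proof.
move=> nF AF; exists (fun n => if unpickle n is Some i then A `&` F i else set0).
split=> [n|].
  case: (unpickle n) => [i|]; first by apply: nowhere_dense_subset (nF i) => x [].
  rewrite /nowhere_dense closure0; apply/seteqP; split=> // x.
  exact: interior_subset.
apply/seteqP; split=> [x Ax|x [n _]]; last by case: unpickle => // i [].
by have [i _ Fix] := AF x Ax; exists (pickle i) => //; rewrite pickleK.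
Qed.

(** * Neighbourhoods of the identity and continuity of the action *)

Section GroupNeighbourhoods.
Variable G : topGroupType.
Implicit Types (g h : G) (U V : set G).

Lemma mulg_near (a b : G) (U : set G) : nbhs (a * b)%g U ->
  exists A B : set G, [/\ nbhs a A, nbhs b B &
    forall x y, A x -> B y -> U (x * y)%g].
Proof.
move=> nU; have [[A B] /= [nA nB] AB] := @mulg_continuous G (a, b) _ nU.
by exists A, B; split=> // x y Ax By; exact: (AB (x, y)).
Qed.

Lemma mulg_contl g : continuous (fun h : G => (g * h)%g).
Proof.
move=> h U nU; have [A [B [nA nB AB]]] := mulg_near nU.
by apply: filterS nB => y By; apply: AB => //; exact: nbhs_singleton.
Qed.

Lemma mulg_contr g : continuous (fun h : G => (h * g)%g).
Proof.
move=> h U nU; have [A [B [nA nB AB]]] := mulg_near nU.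
by apply: filterS nA => y By; apply: AB => //; exact: nbhs_singleton.
Qed.

Lemma sym_nbhs1_sub U : nbhs (1%g : G) U ->
  exists2 V, sym_open_nbhs1 V & V `<=` U.
Proof.
rewrite nbhsE => -[O [oO O1] OU].
exists (O `&` [set x | O (x^-1)%g]); last by move=> x [/OU].
split; last by move=> u [Ou Oiu]; split=> //=; rewrite invgK.
split; last by split=> //=; rewrite invg1.
apply: openI => //.
by have /continuousP/(_ _ oO) := @invg_continuous G.
Qed.

Lemma sym_nbhs1_nbhs U : sym_open_nbhs1 U -> nbhs (1%g : G) U.
Proof. by move=> [/open_nbhs_nbhs]. Qed.

Lemma sym_nbhs1_mem U : sym_open_nbhs1 U -> U 1%g.
Proof. by move=> [[]]. Qed.

Lemma sym_nbhs1_square U : nbhs (1%g : G) U -> exists2 V, sym_open_nbhs1 V &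
  forall a b, V a -> V b -> U (a * b)%g.
Proof.
rewrite -[X in nbhs X](mulg1 1%g) => /mulg_near[A [B [nA nB AB]]].
have [V sV VAB] := sym_nbhs1_sub (filterI nA nB).
by exists V => // a b /VAB[Aa _] /VAB[_ Bb]; exact: AB.
Qed.

Lemma sym_nbhs1_conj U g : nbhs (1%g : G) U -> exists2 V, sym_open_nbhs1 V &
  forall v, V v -> U (g * v * g^-1)%g.
Proof.
move=> nU.
have c : continuous (fun u : G => (g * u * g^-1)%g).
  by move=> u; exact: (cvg_comp _ _ (@mulg_contl g u) (@mulg_contr _ _)).
have nV : nbhs (1%g : G) [set u | U (g * u * g^-1)%g].
  by apply: (c 1%g); rewrite /= mulg1 mulgV.
by have [V sV VU] := sym_nbhs1_sub nV; exists V.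
Qed.

End GroupNeighbourhoods.

Section FlowBasics.
Variables (G : topGroupType) (X : gflow G).
Implicit Types (g h : G) (U V : set G) (A B O W : set X) (x y : X).

Lemma gactK g : cancel (@gact G X g) (gact g^-1%g).
Proof. by move=> x; rewrite -gactM mulVg gact1. Qed.

Lemma gactKV g : cancel (@gact G X g^-1%g) (gact g).
Proof. by move=> x; rewrite -gactM mulgV gact1. Qed.

Lemma gact_near g x A : nbhs (gact g x) A ->
  exists U B, [/\ nbhs g U, nbhs x B & forall u y, U u -> B y -> A (gact u y)].
Proof.
move=> nA; have [[U B] /= [nU nB] UB] := @gact_continuous G X (g, x) _ nA.
by exists U, B; split=> // u y Uu By; exact: (UB (u, y)).
Qed.

Lemma gact_contr g : continuous (@gact G X g).
Proof.
move=> x A nA; have [U [B [nU nB UB]]] := gact_near nA.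
by apply: filterS nB => y By; apply: UB => //; exact: nbhs_singleton.
Qed.

Lemma gact_contl x : continuous (fun g => @gact G X g x).
Proof.
move=> g A nA; have [U [B [nU nB UB]]] := gact_near nA.
by apply: filterS nU => y By; apply: UB => //; exact: nbhs_singleton.
Qed.

Lemma gact_preimage_open g A : open A -> open [set x | A (gact g x)].
Proof. by have /continuousP := @gact_contr g; exact. Qed.

Lemma setact_open U A : open A -> open (setact U A).
Proof.
move=> oA; have -> : setact U A = \bigcup_(u in U) [set x | A (gact u^-1%g x)].
  apply/seteqP; split=> [_ [u Uu [a Aa <-]]|x [u Uu Aux]].
    by exists u => //=; rewrite gactK.
  by exists u => //; exists (gact u^-1%g x) => //; rewrite gactKV.
by apply: bigcup_open => u _; exact: gact_preimage_open.
Qed.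

Lemma setactS U V A B : U `<=` V -> A `<=` B -> setact U A `<=` setact V B.
Proof. by move=> UV AB _ [u Uu [a Aa <-]]; exists u; [exact: UV|exists a; [exact: AB|]]. Qed.

Lemma sub_setact U A : U 1%g -> A `<=` setact U A.
Proof. by move=> U1 a Aa; exists 1%g => //; exists a => //; rewrite gact1. Qed.

Lemma gact_closure g A x : closure A x -> closure (gact g @` A) (gact g x).
Proof.
move=> Ax; apply: closure_of_open_meets => O oO Ogx.
have [y Ay Oy] := closure_meets_open Ax (gact_preimage_open g oO) Ogx.
by exists (gact g y) => //; exists y.
Qed.

Lemma flow_shrink x O : open O -> O x ->
  exists W : set X, [/\ open W, W x & closure W `<=` O].
Proof.
exact: (compact_hausdorff_shrink (@gflow_compact _ X) (@gflow_hausdorff _ X)).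
Qed.

(** Regularity of the flow combined with continuity of the action at (1, x). *)
Lemma flow_shrink1 x A : nbhs x A -> exists U O,
  [/\ sym_open_nbhs1 U, open O, O x & closure (setact U O) `<=` A].
Proof.
rewrite nbhsE => -[A' [oA' A'x] A'A].
have [O' [oO' O'x O'A]] := flow_shrink oA' A'x.
have nO' : nbhs (gact 1%g x) O' by rewrite gact1; exact: open_nbhs_nbhs.
have [U [B [/sym_nbhs1_sub[V sV VU] nB UB]]] := gact_near nO'.
exists V, (interior B); split=> //; first exact: open_interior.
apply: subset_trans A'A; apply: subset_trans O'A; apply: closureS.
move=> _ [u Vu [y /interior_subset By <-]]; apply: UB => //; exact: VU.
Qed.

Lemma minimal_orbit_meets x O : minimal_flow X -> open O -> O !=set0 ->
  exists g, O (gact g x).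
Proof.
move=> [_ mX] oO [y Oy].
by have [_ [g _ <-] Ogx] := dense_meets_open (mX x) oO Oy; exists g.
Qed.

(** The Rosendal criterion localized at a point. On a minimal flow a single such
    point is enough for the criterion, and such points are of first
    countability when the group is metrizable. *)
Definition U_TT_at x :=
  forall U, sym_open_nbhs1 U -> exists2 W, U_TT U W & W x.

(** The orbit map from G is almost open at the identity. On a minimal flow of a
    Polish group this characterizes the points whose orbit is comeager. *)
Definition locally_dense_orbit x :=
  forall U, nbhs (1%g : G) U -> interior (closure (setact U [set x])) x.

Lemma U_TT_subset U A B : U_TT U A -> open B -> B !=set0 -> B `<=` A -> U_TT U B.
Proof.
move=> [oA _ hA] oB B0 BA; split=> // C oC C0 CB.
by apply: (subset_trans BA); apply: hA => //; exact: subset_trans BA.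
Qed.

Lemma U_TT_translate U V g W : U_TT V W -> (forall v, V v -> U (g * v * g^-1)%g) ->
  U_TT U (gact g @` W).
Proof.
move=> [oW [w Ww] hW] VU.
have gWE : gact g @` W = [set x | W (gact g^-1%g x)].
  apply/seteqP; split=> [_ [y Wy <-]|y Wy] /=; first by rewrite gactK.
  by exists (gact g^-1%g y) => //; rewrite gactKV.
split; first by rewrite gWE; exact: gact_preimage_open.
  by exists (gact g w); exists w.
move=> B oB [b Bb] BW _ [y Wy <-].
have clB : closure (setact V [set z | B (gact g z)]) y.
  apply: hW Wy; first exact: gact_preimage_open.
    by exists (gact g^-1%g b); rewrite /= gactKV.
  by move=> y' /BW; rewrite gWE /= gactK.
move: (@gact_closure g _ _ clB); apply: closureS.
move=> _ [_ [v Vv [z Bz <-]] <-]; exists (g * v * g^-1)%g; first exact: VU.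
by exists (gact g z) => //; rewrite -!gactM mulgVK.
Qed.

(** A nonempty open set contains a translate g x; there, gW is U-TT as soon as W
    is V-TT for a V whose conjugate by g lies in U. *)
Lemma U_TT_at_rosendal x : minimal_flow X -> U_TT_at x -> rosendal X.
Proof.
move=> mX hx U sU A oA A0.
have [g Agx] := minimal_orbit_meets x mX oA A0.
have [V sV VU] := sym_nbhs1_conj g (sym_nbhs1_nbhs sU).
have [W hW Wx] := hx V sV.
have hgW := U_TT_translate hW VU.
exists ((gact g @` W) `&` A); last by move=> ? [].
have [ogW _ _] := hgW.
apply: U_TT_subset hgW _ _ _; first exact: openI.
  by exists (gact g x); split=> //; exists x.
by move=> ? [].
Qed.

(** With V V contained in U, the interior of the closure of V x is U-TT: an open
    subset of it meets V x in some v x, and V x = (V v^-1) v x. *)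
Lemma locally_dense_orbit_U_TT_at x : locally_dense_orbit x -> U_TT_at x.
Proof.
move=> hx U sU; have [V sV VU] := sym_nbhs1_square (sym_nbhs1_nbhs sU).
exists (interior (closure (setact V [set x]))); last first.
  exact/hx/sym_nbhs1_nbhs.
split; [exact: open_interior|by exists x; apply/hx/sym_nbhs1_nbhs|].
move=> B oB [b Bb] BW.
have [_ [v Vv [_ -> <-]] Bvx] := closure_meets_open (interior_subset (BW _ Bb)) oB Bb.
apply: (subset_trans (@interior_subset _ _)); apply: closureS.
move=> _ [v' Vv' [_ -> <-]]; exists (v' * v^-1)%g.
  by apply: VU => //; case: sV => _; exact.
by exists (gact v x) => //; rewrite -gactM mulgVK.
Qed.

(** The analogue of the fact that disjoint open sets have disjoint closures in an
    extremally disconnected space: here disjointness has to hold up to a small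
    motion. *)
Lemma G_ED_separation A B U x : G_ED X -> open A -> open B ->
  nbhs (1%g : G) U -> A `&` setact U B = set0 ->
  closure A x -> closure B x -> False.
Proof.
move=> ED oA oB nU AB Ax Bx.
have [V sV VU] := sym_nbhs1_square nU.
have [b Bb Ib] := closure_meets_open Bx (@open_interior _ _)
  (ED A V oA (sym_nbhs1_nbhs sV) _ Ax).
have VBb : setact V B b by apply: sub_setact => //; exact: sym_nbhs1_mem.
have [_ [v Vv [a Aa <-]] [w Vw [c Bc vawc]]] :=
  closure_meets_open (interior_subset Ib) (setact_open V oB) VBb.
suff : (A `&` setact U B) a by rewrite AB.
split=> //; exists (v^-1 * w)%g; first by apply: VU => //; case: sV => _; exact.
by exists c => //; rewrite gactM vawc gactK.
Qed.

(** The analogue of the fact that an extremally disconnected space has no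
    nontrivial convergent sequence. If x is not in the interior of Q_U[x], pick
    points y_n -> x outside Q_U[x]; each has an open neighbourhood W_n such that,
    for some open A_n with x in its closure, W_n misses U A_n. By separation, x
    is not in the closure of V W_n, so after thinning the W_n converge to x and
    are pairwise V-separated. Then the union of the W_n with n even and that of
    the W_n with n odd are V-separated and both accumulate at x, a
    contradiction. *)
Lemma first_countable_G_isolated x : G_ED X -> first_countable_at x ->
  G_isolated x.
Proof.
move=> ED [B [nB baseB]] U sU; apply: contrapT => nQ.
have [V sV VU] := sym_nbhs1_square (sym_nbhs1_nbhs sU).
(* The open sets W_n of the proof: they are apart from some A accumulating at x. *)
pose good W := [/\ open W, W !=set0 &
  exists A, [/\ open A, closure A x & W `&` setact U A = set0]].
have goodN N : nbhs x N -> exists2 W, good W & W `<=` N.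
  rewrite nbhsE => -[O [oO Ox] ON].
  have [y [Oy nQy]] : (O `\` Q_ U x) !=set0.
    apply: contrapT => h; apply: nQ; apply: (interior_mem_open oO Ox) => y Oy.
    by apply: contrapT => nQy; apply: h; exists y.
  have [A [oA Ax nyA]] : exists A, [/\ open A, closure A x &
      ~ closure (setact U A) y].
    apply: contrapT => h; apply: nQy => A [oA Ax]; apply: contrapT => nyA.
    by apply: h; exists A.
  exists (O `\` closure (setact U A)); last by move=> z [/ON].
  split; [|by exists y|exists A; split=> //].
    by apply: openI => //; rewrite openC; exact: closed_closure.
  by apply/seteqP; split=> // z [[_ nz] ?]; apply: nz; exact: subset_closure.
have goodx W : good W -> nbhs x (~` closure (setact V W)).
  move=> [oW _ [A [oA Ax WA]]].
  apply: open_nbhs_nbhs; split; first by rewrite openC; exact: closed_closure.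
  move=> VWx; apply: (G_ED_separation ED (setact_open V oW) oA (sym_nbhs1_nbhs sV)
    _ VWx Ax).
  apply/seteqP; split=> // _ [[v Vv [w Ww <-]] [v' Vv' [a Aa eq]]].
  suff : (W `&` setact U A) w by rewrite WA.
  split=> //; exists (v^-1 * v')%g; first by apply: VU => //; case: sV => _; exact.
  by exists a => //; rewrite gactM eq gactK.
pose T := {N : set X | nbhs x N}.
have choose (N : T) : {W | good W /\ W `<=` sval N}.
  by apply: cid; case: N => N /= /goodN[W]; exists W.
have nextP (n : nat) (N : T) :
    nbhs x (sval N `&` ~` closure (setact V (sval (choose N))) `&` B n).
  apply: filterI => //; apply: filterI; first exact: (svalP N).
  by apply: goodx; case: (svalP (choose N)).
(* N n is the neighbourhood of x left available at stage n; cutting it down with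
   B n forces W n to converge to x. *)
pose N := fix N n : T := if n is m.+1 then exist _ _ (nextP m (N m))
  else exist _ setT (@filterT _ (nbhs x) (nbhs_filter x)).
pose W n := sval (choose (N n)).
have WP n : good (W n) /\ W n `<=` sval (N n) := svalP (choose (N n)).
have NS n : sval (N n.+1) = sval (N n) `&` ~` closure (setact V (W n)) `&` B n by [].
have Nle m n : (m <= n)%N -> sval (N n) `<=` sval (N m).
  elim: n => [|n IH]; first by rewrite leqn0 => /eqP ->.
  rewrite leq_eqVlt => /orP[/eqP ->//|/IH h].
  by apply: subset_trans h; rewrite NS => z [[]].
have Wlt m n : (m < n)%N -> W n `&` setact V (W m) = set0.
  move=> mn; apply/seteqP; split=> // z [/(proj2 (WP n)) /(Nle _ _ mn)].
  by rewrite NS => -[[_ nz] _] ?; apply: nz; exact: subset_closure.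
have Wne m n : m <> n -> W n `&` setact V (W m) = set0.
  move=> /eqP; rewrite neq_ltn => /orP[/Wlt//|/Wlt h].
  apply/seteqP; split=> // y [Wy [v Vv [w Ww vwy]]]; rewrite -vwy in Wy => {vwy}.
  suff : (W m `&` setact V (W n)) w by rewrite h.
  split=> //; exists v^-1%g; first by case: sV => _; exact.
  by exists (gact v w) => //; rewrite gactK.
pose C (b : bool) := \bigcup_(n in [set n | odd n = b]) W n.
have oC b : open (C b) by apply: bigcup_open => n _; have [[]] := WP n.
have clC b : closure (C b) x.
  apply: closure_of_open_meets => O oO Ox.
  have [n BO] := baseB O (open_nbhs_nbhs (conj oO Ox)).
  (* An index of parity b beyond n. *)
  pose k := if odd n.+1 == b then n.+1 else n.+2.
  have kb : odd k = b.
    by rewrite /k; case: ifP => [/eqP//|] /=; case: (odd n); case: (b).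
  have nk : (n < k)%N by rewrite /k; case: ifP.
  have [[_ [w Ww] _] Wk] := WP k; exists w; first by exists k.
  by apply: BO; have := Nle _ _ nk _ (Wk _ Ww); rewrite NS => -[].
apply: (G_ED_separation ED (oC true) (oC false) (sym_nbhs1_nbhs sV) _ (clC _) (clC _)).
apply/seteqP; split=> // z [[n /= on Wn] [v Vv [w [m /= om Wm] vwz]]].
have nm : m <> n by move=> mn; move: om; rewrite mn on.
suff : (W n `&` setact V (W m)) z by rewrite Wne.
by split=> //; exists v => //; exists w.
Qed.

End FlowBasics.

(** * Countable bases and complete metrics on Polish groups *)

Section CompatibleMetric.
Variables (R : realType) (T : topologicalType) (d : T -> T -> R).
Hypothesis cd : compatible_metric d.
Implicit Types (x y z : T) (e : R) (O A : set T).

Lemma compatible_metric_refl x : d x x = 0.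
Proof. by have [[_ + _ _] _] := cd => /(_ x x) [_ ->]. Qed.

Lemma compatible_metric_sym x y : d x y = d y x.
Proof. by have [[_ _ + _] _] := cd. Qed.

Lemma compatible_metric_triangle y x z : d x z <= d x y + d y z.
Proof. by have [[_ _ _ +] _] := cd. Qed.

Lemma metric_ball_open x e : open [set y | d x y < e].
Proof.
rewrite openE => y /= xy; rewrite /interior; have [_ cN] := cd.
apply/(cN y); exists (e - d x y); first by rewrite subr_gt0.
by move=> z /=; rewrite ltrBrDl; apply: le_lt_trans; exact: compatible_metric_triangle.
Qed.

Lemma metric_ball_nbhs x e : 0 < e -> nbhs x [set y | d x y < e].
Proof.
move=> e0; apply: open_nbhs_nbhs; split=> /=.
  exact: metric_ball_open.
by rewrite compatible_metric_refl.
Qed.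

Lemma nbhs_metric_ball x A : nbhs x A -> exists2 e, 0 < e & [set y | d x y < e] `<=` A.
Proof. by have [_ cN] := cd => /(cN x). Qed.

Lemma closure_metric_ball x y e : closure [set y | d x y < e] y -> d x y <= e.
Proof.
move=> xy; apply/ler_addgt0Pr => f f0.
have fy : d y y < f by rewrite compatible_metric_refl.
have [z /= xz yz] := closure_meets_open xy (@metric_ball_open y f) fy.
by rewrite (le_trans (compatible_metric_triangle z _ _))// lerD// ltW// compatible_metric_sym.
Qed.

End CompatibleMetric.

Lemma inv_natr_lt (R : realType) (e : R) : 0 < e -> exists n : nat, n.+1%:R^-1 < e.
Proof.
by move=> e0; have [n _ h] := near_infty_natSinv_lt (PosNum e0); exists n; apply: h => /=.
Qed.

Section Polish.
Variables (R : realType) (G : topGroupType).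
Hypothesis polishG : polish R G.

Lemma polish_nbhs1_base : exists U : nat -> set G,
  (forall n, sym_open_nbhs1 (U n)) /\
  forall N, nbhs (1%g : G) N -> exists n, U n `<=` N.
Proof.
have [_ [d [cd _]]] := polishG.
have h (n : nat) : {V : set G | sym_open_nbhs1 V /\
    V `<=` [set y | d 1%g y < n.+1%:R^-1]}.
  apply: cid; have := @metric_ball_nbhs R G d cd 1%g n.+1%:R^-1.
  by rewrite invr_gt0 ltr0n => /(_ isT)/sym_nbhs1_sub[V sV VU]; exists V.
exists (fun n => sval (h n)); split=> [n|N nN]; first by have [] := svalP (h n).
have [e e0 eN] := nbhs_metric_ball cd nN.
have [n ne] := inv_natr_lt e0; exists n.
have [_ hn] := svalP (h n); apply: (subset_trans hn); apply: subset_trans eN.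
by move=> y /= /lt_trans; exact.
Qed.

Lemma polish_dense_seq : exists s : nat -> G,
  forall O g, open O -> O g -> exists n, O (s n).
Proof.
have [[S [cS dS]] _] := polishG.
have /countable_injP[f injf] := cS.
exists (fun n => xget 1%g [set y | S y /\ f y = n]) => O g oO Og.
have [y Sy Oy] := dense_meets_open dS oO Og; exists (f y).
case: xgetP => [z _ [Sz fzy]|/(_ y)]; last by case.
by rewrite (_ : z = y)//; apply: injf; rewrite ?inE.
Qed.

(** A sequence of countable covers of G by open balls whose nested branches
    converge. Passing to a member of the next cover with closure inside the
    present one replaces the choice of a convergent sequence in G. The radius is
    at most 1 / n.+1, and the second component of the index makes it as small as
    needed. *)
Lemma polish_scheme : exists B : nat -> nat * nat -> set G,
  [/\ forall n k, open (B n k),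
      forall n g O, open O -> O g ->
        exists k, B n k g /\ closure (B n k) `<=` O
    & forall k : nat -> nat * nat, (forall n, B n (k n) !=set0) ->
        (forall n, closure (B n.+1 (k n.+1)) `<=` B n (k n)) ->
        exists l, (forall n, B n (k n) l) /\
          forall O, nbhs l O -> exists n, B n (k n) `<=` O].
Proof.
have [s dense_s] := polish_dense_seq; have [_ [d [cd complete_d]]] := polishG.
pose rad n : R := n.+1%:R^-1.
have rad_gt0 n : 0 < rad n by rewrite invr_gt0 ltr0n.
have rad_le m n : (m <= n)%N -> rad n <= rad m.
  by move=> mn; rewrite lef_pV2 ?posrE ?ltr0n// ler_nat.
have small e : 0 < e -> exists n, rad n + rad n < e.
  move=> e0; have [n ne] := inv_natr_lt (divr_gt0 e0 (ltr0n R 2)).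
  by exists n; rewrite [e]splitr ltrD.
pose B n (k : nat * nat) : set G := [set y | d (s k.1) y < rad (n + k.2)%N].
have Bdist n k y z : B n k y -> B n k z -> d y z < rad n + rad n.
  move=> By Bz; rewrite (le_lt_trans (compatible_metric_triangle cd (s k.1) y z))//.
  have le_rad := rad_le _ _ (leq_addr k.2 n).
  by rewrite (compatible_metric_sym cd) ltrD// (lt_le_trans _ le_rad).
exists B; split.
- by move=> n k; exact: metric_ball_open cd _ _.
- move=> n g O oO Og; have [e e0 eO] := nbhs_metric_ball cd (open_nbhs_nbhs (conj oO Og)).
  have [j je] := small e e0.
  have radj : rad (n + j)%N <= rad j by rewrite rad_le// leq_addl.
  have gg : d g g < rad (n + j)%N by rewrite (compatible_metric_refl cd).
  have [i /= gi] := dense_s _ _ (@metric_ball_open _ _ _ cd g (rad (n + j)%N)) gg.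
  exists (i, j); split; first by rewrite /B /= (compatible_metric_sym cd).
  move=> y /(closure_metric_ball cd) /= iy; apply: eO => /=.
  rewrite (le_lt_trans (compatible_metric_triangle cd (s i) g y))//.
  by rewrite (le_lt_trans _ je)// lerD// ?(le_trans iy)// (le_trans (ltW gi)).
move=> k B0 BS.
have Ble m n : (m <= n)%N -> B n (k n) `<=` B m (k m).
  elim: n => [|n IH]; first by rewrite leqn0 => /eqP ->.
  rewrite leq_eqVlt => /orP[/eqP ->//|/IH h].
  by apply: subset_trans h; apply: subset_trans (BS n); exact: subset_closure.
pose u n := sval (cid (B0 n)); have Bu n : B n (k n) (u n) := svalP (cid (B0 n)).
have [e e0|l ul] := complete_d u.
  have [N Ne] := small e e0; exists N => m n Nm Nn; apply: lt_trans Ne.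
  by apply: (@Bdist N (k N)); [exact: (Ble _ _ Nm)|exact: (Ble _ _ Nn)].
have Bl n : B n (k n) l.
  apply: BS => A /ul [N _ NA]; exists (u (maxn n.+1 N)); split.
    by apply: (Ble n.+1 _ _ _ (Bu _)); exact: leq_maxl.
  by apply: NA => /=; exact: leq_maxr.
exists l; split=> // O nO; have [e e0 eO] := nbhs_metric_ball cd nO.
have [n ne] := small e e0; exists n => y By; apply: eO => /=.
by apply: lt_trans ne; exact: Bdist.
Qed.

End Polish.

Lemma polish_hausdorff (R : realType) (G : topGroupType) :
  polish R G -> hausdorff_space G.
Proof.
move=> [_ [d [cd _]]] x y xy; have [[d0 deq _ _] _] := cd.
apply/deq/eqP; rewrite eq_le d0 andbT; apply/ler_addgt0Pr => e e0.
have e20 : 0 < e / 2 by rewrite divr_gt0.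
have [z [/= xz yz]] := xy _ _ (metric_ball_nbhs cd x e20) (metric_ball_nbhs cd y e20).
rewrite add0r [e]splitr (le_trans (compatible_metric_triangle cd z x y))//.
by rewrite lerD// ltW// (compatible_metric_sym cd).
Qed.

(** * Locally dense orbits are the comeager ones *)

Section LocallyDenseOrbits.
Variables (G : topGroupType) (X : gflow G).
Implicit Types (g h : G) (U V W : set G) (A B O : set X) (x y : X).

Lemma locally_dense_orbit_gact x g W : locally_dense_orbit x -> open W -> W g ->
  interior (closure (setact W [set x])) (gact g x).
Proof.
move=> hx oW Wg.
have nU : nbhs (1%g : G) [set u | W (g * u)%g].
  apply: (@mulg_contl G g 1%g); rewrite mulg1.
  exact: open_nbhs_nbhs.
have oI := @open_interior _ (closure (setact [set u | W (g * u)%g] [set x])).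
apply: (interior_mem_open (gact_preimage_open g^-1%g oI)) => /=.
  by rewrite gactK; exact: hx.
move=> y /interior_subset hy; rewrite -[y](gactKV g).
move: (@gact_closure _ _ g _ _ hy); apply: closureS.
by move=> _ [_ [u Wgu [_ -> <-]] <-]; exists (g * u)%g => //; exists x => //; rewrite gactM.
Qed.

(** If the closure of V x has an interior point, it has one of the form v x, and
    translating by v^-1 moves it to x. *)
Lemma somewhere_dense_locally_dense x :
  (forall V, sym_open_nbhs1 V ->
    interior (closure (setact V [set x])) !=set0) -> locally_dense_orbit x.
Proof.
move=> hx U nU; have [V sV VU] := sym_nbhs1_square nU.
have [y Iy] := hx V sV; have oI := @open_interior _ (closure (setact V [set x])).
have [_ [v Vv [_ -> <-]] Ivx] := closure_meets_open (interior_subset Iy) oI Iy.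
apply: (interior_mem_open (gact_preimage_open v oI)) => //= z /interior_subset hz.
rewrite -[z](gactK v); move: (@gact_closure _ _ v^-1%g _ _ hz); apply: closureS.
move=> _ [_ [w Vw [_ -> <-]] <-]; exists (v^-1 * w)%g.
  by apply: VU => //; case: sV => _; exact.
by exists x => //; rewrite gactM.
Qed.

Lemma nowhere_dense_gact g A : nowhere_dense A -> nowhere_dense (gact g @` A).
Proof.
move=> nA; apply/seteqP; split=> // y Iy.
have oI := @open_interior _ (closure (gact g @` A)).
suff : interior (closure A) (gact g^-1%g y) by rewrite nA.
apply: (interior_mem_open (gact_preimage_open g oI)); first by rewrite /= gactKV.
move=> z /= /interior_subset /(@gact_closure _ _ g^-1%g); rewrite gactK.
by apply: closureS => _ [_ [a Aa <-] <-]; rewrite gactK.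
Qed.

End LocallyDenseOrbits.

Section PolishLocallyDenseOrbits.
Variables (R : realType) (G : topGroupType) (polishG : polish R G).
Variable X : gflow G.
Implicit Types (g h : G) (U V W : set G) (A B O : set X) (x y : X).

(** The group is a countable union of translates of V, so if V x were nowhere
    dense then the orbit, and with it the whole flow, would be meager. *)
Lemma comeager_orbit_locally_dense x : comeager (Defs.orbit x) ->
  locally_dense_orbit x.
Proof.
move=> [F [nF orbF]]; apply: somewhere_dense_locally_dense => V sV.
apply: contrapT => hV; have [s dense_s] := polish_dense_seq polishG.
have nV : nowhere_dense (setact V [set x]).
  by apply/seteqP; split=> // y Iy; case: hV; exists y.
pose E (i : nat + nat) := match i with
  | inl n => F n | inr n => gact (s n) @` setact V [set x] end.
have nE i : nowhere_dense (E i) by case: i => n //=; exact: nowhere_dense_gact.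
have [z _ nz] := compact_baire_countable (@gflow_compact _ X)
  (@gflow_hausdorff _ X) nE openT (ex_intro [set: X] x I).
have [g _ gxz] : Defs.orbit x z.
  apply: contrapT => nzx; have : (~` Defs.orbit x) z by [].
  by rewrite orbF => -[n _ Fz]; exact: (nz (inl n)).
have [n sn] : exists n, V ((s n)^-1 * g)%g.
  have oV' : open [set h | V (h^-1 * g)%g].
    have ch : continuous (fun h : G => (h^-1 * g)%g).
      by move=> h; exact: (cvg_comp _ _ (@invg_continuous G h) (@mulg_contr _ _ _)).
    by have /continuousP/(_ V) := ch; apply; case: sV => [[]].
  by apply: (dense_s _ g oV') => /=; rewrite mulVg; exact: sym_nbhs1_mem.
apply: (nz (inr n)); exists (gact ((s n)^-1 * g)%g x).
  by exists ((s n)^-1 * g)%g => //; exists x.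
by rewrite -gactM mulVKg.
Qed.

(** By minimality and separability of G, countably many translates of the closure
    of V x cover X, hence countably
    many translates of the closure of V f(x) cover Y, and one of these has
    interior points. *)
Lemma locally_dense_orbit_factor (Y : gflow G) (f : X -> Y) x :
  minimal_flow X -> gmap f -> range f = setT -> locally_dense_orbit x ->
  locally_dense_orbit (f x).
Proof.
move=> mX [cf ef] sf hx; apply: somewhere_dense_locally_dense => V sV.
apply: contrapT => hV; have [s dense_s] := polish_dense_seq polishG.
pose E n := gact (s n)^-1%g @` closure (setact V [set f x]).
have nE n : nowhere_dense (E n).
  apply: nowhere_dense_gact; rewrite /nowhere_dense.
  rewrite (_ : closure (closure _) = closure (setact V [set f x])).
    by apply/seteqP; split=> // y Iy; case: hV; exists y.
  exact/esym/closure_id/closed_closure.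
have [y _ ny] := compact_baire_countable (@gflow_compact _ Y)
  (@gflow_hausdorff _ Y) nE openT (ex_intro [set: Y] (f x) I).
have [z _ fzy] : range f y by rewrite sf.
have oI := @open_interior _ (closure (setact V [set x])).
have [g Ig] := minimal_orbit_meets z mX oI (ex_intro _ x (hx V (sym_nbhs1_nbhs sV))).
have oW : open [set h | interior (closure (setact V [set x])) (gact h z)].
  by have /continuousP/(_ _ oI) := @gact_contl _ _ z.
have [n /= /interior_subset In] := dense_s _ g oW Ig.
apply: (ny n); exists (f (gact (s n) z)); last by rewrite ef gactK.
apply: closure_of_open_meets => O oO Of.
have oO' : open (f @^-1` O) by have /continuousP/(_ _ oO) := cf.
have [_ [v Vv [_ -> <-]] Ovx] := closure_meets_open In oO' Of.
by exists (gact v (f x)); [exists v => //; exists (f x)|rewrite -ef].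
Qed.

(** The open mapping argument. For V open, all points y in the interior of the
    closure of V x, outside a nowhere dense set, also lie in the interior of the
    closure of V' x for some V' of small diameter with closure in V. If y avoids
    these exceptions for countably many V, iterating this from V = W gives open
    sets shrinking to an element l of W, and then y = l x. *)
Lemma locally_dense_orbit_meager x W : locally_dense_orbit x -> open W ->
  meager (interior (closure (setact W [set x])) `\` setact W [set x]).
Proof.
move=> hx oW; have [B [oB Bbase Blim]] := polish_scheme polishG.
pose I (V : set G) := interior (closure (setact V [set x])).
pose next n (V : set G) := \bigcup_(k in [set k | closure (B n k) `<=` V]) I (B n k).
have nD n V : open V -> nowhere_dense (I V `\` next n V).
  move=> oV; apply: nowhere_dense_open_diff; first exact: open_interior.
    by apply: bigcup_open => k _; exact: open_interior.
  apply: subset_trans (@interior_subset _ _) _; apply: closureS.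
  move=> _ [g Vg [_ -> <-]]; have [k [Bg BV]] := Bbase n g V oV Vg.
  by exists k => //; exact: locally_dense_orbit_gact.
pose D (i : option (nat * (nat * nat))) := match i with
  | None => I W `\` next 0%N W
  | Some (n, k) => I (B n k) `\` next n.+1 (B n k) end.
apply: (@meager_countable_cover X _ D).
  by case=> [[n k]|]; apply: nD.
move=> y [Iy nWy]; apply: contrapT => nDy.
have nextP i : ~ D i y by move=> Diy; apply: nDy; exists i.
have [k0 /= k0W Iyk0] : next 0%N W y.
  by apply: contrapT => h; apply: (nextP None).
have step n (k : {k | I (B n k) y}) : {k' : {k' | I (B n.+1 k') y} |
    closure (B n.+1 (sval k')) `<=` B n (sval k)}.
  apply: cid; case: k => k Ik /=.
  have [k' /= k'B Ik'] : next n.+1 (B n k) y.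
    by apply: contrapT => h; apply: (nextP (Some (n, k))).
  by exists (exist _ k' Ik').
pose k := fix k n : {k | I (B n k) y} := match n with
  | 0%N => exist _ k0 Iyk0 | m.+1 => sval (step m (k m)) end.
have Ik n : I (B n (sval (k n))) y := svalP (k n).
have meet n A : nbhs y A -> exists2 g, B n (sval (k n)) g & A (gact g x).
  by move=> /(interior_subset (Ik n))[_ [[g Bg [_ -> <-]] Agx]]; exists g.
have [n|n|l [Bl lO]] := Blim (fun n => sval (k n)).
- by have [g Bg _] := meet n setT (@filterT _ (nbhs y) (nbhs_filter y)); exists g.
- exact: (svalP (step n (k n))).
apply: nWy; exists l; first by apply/k0W/subset_closure/(Bl 0%N).
exists x => //; apply: (@gflow_hausdorff _ X) => P Q nP nQ.
have [n nBP] := lO _ (gact_contl nP).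
by have [g /nBP Pgx Qgx] := meet n Q nQ; exists (gact g x).
Qed.

Lemma locally_dense_orbit_comeager x : minimal_flow X ->
  locally_dense_orbit x -> comeager (Defs.orbit x).
Proof.
move=> [_ mX] hx; have := locally_dense_orbit_meager hx (@openT G).
have <- : Defs.orbit x = setact setT [set x].
  apply/seteqP; split=> [_ [g _ <-]|_ [g _ [_ -> <-]]]; last by exists g.
  by exists g => //; exists x.
suff -> : interior (closure (Defs.orbit x)) = setT by rewrite setTD.
apply/seteqP; split=> // y _; apply: (interior_mem_open openT) => // z _.
by apply: closure_of_open_meets => O; exact: dense_meets_open.
Qed.

(** The orbit map is open onto its image. If g x is close to x, then V x and V g x
    are both comeager in one nonempty open set, hence they intersect. *)
Lemma locally_dense_orbit_open x U : locally_dense_orbit x ->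
  nbhs (1%g : G) U -> exists N, [/\ open N, N x &
    forall g, N (gact g x) -> exists2 u, U u & gact g x = gact u x].
Proof.
move=> hx nU; have [V sV VU] := sym_nbhs1_square nU.
have oV : open V by case: sV => [[]].
exists (interior (closure (setact V [set x]))).
split; [exact: open_interior|exact/hx/sym_nbhs1_nbhs|move=> g Ng].
pose W : set G := [set h | V (h * g^-1)%g].
have oW : open W by have /continuousP/(_ V oV) := @mulg_contr G g^-1%g.
have Wg : W g by rewrite /W /= mulgV; exact: sym_nbhs1_mem.
have hg := locally_dense_orbit_gact hx oW Wg.
have [F [nF FE]] := locally_dense_orbit_meager hx oV.
have [F' [nF' F'E]] := locally_dense_orbit_meager hx oW.
pose E (i : nat + nat) := match i with inl n => F n | inr n => F' n end.
have nE i : nowhere_dense (E i) by case: i.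
have [z [Iz I'z] nz] := compact_baire_countable (@gflow_compact _ X)
  (@gflow_hausdorff _ X) nE (openI (@open_interior _ _) (@open_interior _ _))
  (ex_intro _ _ (conj Ng hg)).
have [v Vv [_ -> vxz]] : setact V [set x] z.
  apply: contrapT => h; have : (\bigcup_n F n) z by rewrite -FE.
  by move=> [n _ Fz]; exact: (nz (inl n)).
have [w Ww [_ -> wxz]] : setact W [set x] z.
  apply: contrapT => h; have : (\bigcup_n F' n) z by rewrite -F'E.
  by move=> [n _ Fz]; exact: (nz (inr n)).
exists ((w * g^-1)^-1 * v)%g; first by apply: VU => //; case: sV => _; exact.
by rewrite gactM vxz -wxz -gactM invgM invgK mulgVK.
Qed.

End PolishLocallyDenseOrbits.

(** * From the Rosendal criterion to a locally dense orbit *)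

Section Rosendal.
Variables (R : realType) (G : topGroupType) (polishG : polish R G).
Variable X : gflow G.
Implicit Types (g h : G) (U V : set G) (A B O W : set X) (x y : X).

Lemma U_TT_widen U V W : U `<=` V -> U_TT U W -> U_TT V W.
Proof.
move=> UV [oW W0 hW]; split=> // B oB B0 BW.
by apply: (subset_trans (hW B oB B0 BW)); apply: closureS; exact: setactS.
Qed.

(** If A_n is U_n-TT and contains x, then A_n is contained in the closure of
    U_n O for every open O containing x. For small O and large n this closure is
    inside any prescribed neighbourhood of x, so the A_n form a base at x. *)
Lemma U_TT_at_first_countable x : U_TT_at x -> first_countable_at x.
Proof.
move=> hx; have [U [sU baseU]] := polish_nbhs1_base polishG.
have hA n : {A : set X | U_TT (U n) A /\ A x}.
  by apply: cid; have [A] := hx (U n) (sU n); exists A.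
exists (fun n => sval (hA n)); split=> [n|N nN].
  by have [[oA _ _] Ax] := svalP (hA n); exact: open_nbhs_nbhs.
have [V [O [sV oO Ox ON]]] := flow_shrink1 nN.
have [n UV] := baseU V (sym_nbhs1_nbhs sV); exists n.
have [[oA _ AU] Ax] := svalP (hA n).
apply: subset_trans ON; apply: (subset_trans (AU (O `&` sval (hA n)) _ _ _)).
- exact: openI.
- by exists x.
- by move=> ? [].
- by apply: closureS; apply: setactS => // ? [].
Qed.

Definition U_TT_points U : set X := \bigcup_(W in U_TT (X:=X) U) W.

Lemma rosendal_U_TT_points U : rosendal X -> sym_open_nbhs1 U ->
  nowhere_dense (~` U_TT_points U).
Proof.
move=> rX sU; rewrite -setTD; apply: nowhere_dense_open_diff.
- exact: openT.
- by apply: bigcup_open => W [].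
move=> x _; apply: closure_of_open_meets => O oO Ox.
have [W hW WO] := rX U sU O oO (ex_intro _ x Ox).
by have [_ [w Ww] _] := hW; exists w; [exists W|exact: WO].
Qed.

Lemma rosendal_exists_U_TT_at : [set: X] !=set0 -> rosendal X ->
  exists x : X, U_TT_at x.
Proof.
move=> X0 rX; have [U [sU baseU]] := polish_nbhs1_base polishG.
have [x _ hx] := compact_baire (@gflow_compact _ X) (@gflow_hausdorff _ X)
  (fun n => rosendal_U_TT_points rX (sU n)) openT X0.
exists x => V sV; have [n UV] := baseU V (sym_nbhs1_nbhs sV).
have [W hW Wx] := contrapT (hx n).
by exists W => //; exact: U_TT_widen hW.
Qed.

(** The translates of a countable base at x by a countable dense set of group
    elements. *)
Lemma first_countable_pi_base x : minimal_flow X -> first_countable_at x ->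
  exists P : nat * nat -> set X, (forall k, open (P k) /\ P k !=set0) /\
    forall O, open O -> O !=set0 -> exists k, P k `<=` O.
Proof.
move=> mX [B [nB baseB]]; have [s dense_s] := polish_dense_seq polishG.
pose P (k : nat * nat) := [set y | interior (B k.2) (gact (s k.1)^-1%g y)].
exists P; split=> [k|O oO O0].
  split; first by apply: gact_preimage_open; exact: open_interior.
  by exists (gact (s k.1) x); rewrite /P /= gactK; exact: nB.
have [g Og] := minimal_orbit_meets x mX oO O0.
have oO' : open [set h | O (gact h x)].
  by have /continuousP/(_ _ oO) := @gact_contl _ _ x.
have [i /= Oi] := dense_s _ g oO' Og.
have oOi := gact_preimage_open (s i) oO.
have [j BO] := baseB _ (open_nbhs_nbhs (conj oOi Oi)).
by exists (i, j) => y /interior_subset/BO /=; rewrite gactKV.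
Qed.

(** The Rosendal criterion already makes X have a countable pi-base P, which is
    all that the usual argument for metrizable flows needs. For n and k, if A is
    U_n-TT and contains P_k then U_n P_k is dense in A. A generic x is therefore in
    U_n P_k whenever it lies in such an A; equivalently U_n x meets P_k. As the P_k
    form a pi-base, U_n x is dense in A. *)
Lemma rosendal_exists_locally_dense : minimal_flow X -> rosendal X ->
  exists x : X, locally_dense_orbit x.
Proof.
move=> mX rX; have [X0 _] := mX.
have [x0 hx0] := rosendal_exists_U_TT_at X0 rX.
have [P [oP baseP]] := first_countable_pi_base mX (U_TT_at_first_countable hx0).
have [U [sU baseU]] := polish_nbhs1_base polishG.
pose T (i : nat * (nat * nat)) :=
  \bigcup_(A in [set A | U_TT (U i.1) A /\ P i.2 `<=` A]) A.
pose E (i : nat + nat * (nat * nat)) := match i with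
  | inl n => ~` U_TT_points (U n)
  | inr i => T i `\` setact (U i.1) (P i.2) end.
have nE i : nowhere_dense (E i).
  case: i => [n|i]; first exact: rosendal_U_TT_points.
  have [oPi Pi0] := oP i.2.
  apply: nowhere_dense_open_diff; [|exact: setact_open|].
    by apply: bigcup_open => A [[]].
  by move=> y [A [[_ _ hA] PA] Ay]; exact: hA Ay.
have [x _ hx] := compact_baire_countable (@gflow_compact _ X)
  (@gflow_hausdorff _ X) nE openT X0.
exists x => V nV; have [n UV] := baseU V nV.
have [A [oA A0 hA] Ax] := contrapT (hx (inl n)).
apply: (interior_mem_open oA Ax) => a Aa.
apply: closure_of_open_meets => O oO Oa.
have [k PO] := baseP (O `&` A) (openI oO oA) (ex_intro _ a (conj Oa Aa)).
have PA : P k `<=` A by move=> z /PO[].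
have [u Uu [p Pp upx]] : setact (U n) (P k) x.
  apply: contrapT => h; apply: (hx (inr (n, k))); split=> //=.
  by exists A.
exists p; last by have [] := PO _ Pp.
exists u^-1%g; last by exists x => //; rewrite -upx gactK.
by apply: UV; case: (sU n) => _; exact.
Qed.

End Rosendal.

(** * The pseudometric associated with a right-invariant metric *)

Section PartialDistance.
Variables (R : realType) (G : topGroupType) (d : G -> G -> R) (X : gflow G).
Hypotheses (cd : compatible_metric d) (rd : right_invariant d).

Lemma Bd_sym_open (c : R) : 0 < c -> sym_open_nbhs1 (Bd d c).
Proof.
move=> c0; have BE : Bd d c = [set g | d 1%g g < c].
  by apply/seteqP; split=> g; rewrite /Bd /= (compatible_metric_sym cd).
split; last first.
  by move=> g; rewrite BE /= => gc; rewrite -(rd _ _ g) mul1g mulVg (compatible_metric_sym cd).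
by rewrite BE; split; [exact: metric_ball_open|rewrite /= (compatible_metric_refl cd)].
Qed.

Lemma Bd_mul (a b : R) g h : Bd d a g -> Bd d b h -> Bd d (a + b) (g * h)%g.
Proof.
rewrite /Bd /= => ga hb; rewrite (le_lt_trans (compatible_metric_triangle cd h _ _))//.
by rewrite ltrD// -{2}[h]mul1g rd.
Qed.

Lemma Bd_subset (a b : R) : a <= b -> Bd d a `<=` Bd d b.
Proof. by move=> ab g /lt_le_trans; exact. Qed.

Lemma G_isolated_partial_compatible (x : X) : G_isolated x ->
  partial_compatible d x.
Proof.
move=> hx c c0; have c20 : 0 < c / 2 by rewrite divr_gt0.
apply: filterS (hx _ (Bd_sym_open c20)) => z Qz /=.
apply: (@le_lt_trans _ _ (c / 2)%:E); last first.
  by rewrite lte_fin ltr_pdivrMr// ltr_pMr// ltr1n.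
apply/partial_dP; first exact: ltW.
move=> e e0 A oA Ax; move: (Qz A (conj oA (subset_closure Ax))).
by apply: closureS; apply: setactS => //; apply: Bd_subset; rewrite lerDl ltW.
Qed.

(** Let B be open in a small ball around x for the pseudometric. Closeness of a
    point of B to x puts x in the closure of Bd(e) B. The definition of the
    pseudometric applies only to open sets containing x, and the G-ED property
    provides one: x is in the interior of the closure of Bd(e) Bd(e) B. Closeness
    of x to the other points of the ball then uses up a last e. *)
Lemma partial_compatible_U_TT_at (x : X) : G_ED X -> partial_compatible d x ->
  U_TT_at x.
Proof.
move=> ED hx U sU; have [c c0 cU] := nbhs_metric_ball cd (sym_nbhs1_nbhs sU).
(* Any e with 3 e <= c works. *)
pose e := c / 4; have e0 : 0 < e by rewrite divr_gt0.
have BU : Bd d (e + (e + e)) `<=` U.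
  move=> g; rewrite /Bd /= (compatible_metric_sym cd) => g3; apply: cU => /=.
  by move: g3; rewrite /e; lra.
have near z : (partial_d d x z < e%:E)%E ->
    forall A, open A -> A x -> closure (setact (Bd d e) A) z.
  move=> /ereal_inf_lt[_ [b [b0 pb] <-]]; rewrite lte_fin => be A oA Ax.
  by rewrite -(subrKC b e); apply: pb => //; rewrite subr_gt0.
pose W := interior [set z : X | (partial_d d x z < e%:E)%E].
exists W; last exact: hx.
split; [exact: open_interior|by exists x; exact: hx|].
move=> B oB [b Bb] BW y /interior_subset/near hy.
have [sB oBe] := (Bd_sym_open e0, Bd_sym_open e0).
have xB : closure (setact (Bd d e) B) x.
  apply: closure_of_open_meets => O oO Ox.
  have clO := near _ (interior_subset (BW _ Bb)) O oO Ox.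
  have [_ [v Vv [z Oz <-]] Bvz] := closure_meets_open clO oB Bb.
  exists z => //; exists v^-1%g; first by case: sB => _; exact.
  by exists (gact v z) => //; rewrite gactK.
have xI := ED _ _ (setact_open (Bd d e) oB) (sym_nbhs1_nbhs sB) _ xB.
apply: closure_of_open_meets => O oO Oy.
have [_ [v Vv [z Iz <-]] Ovz] := closure_meets_open
  (hy _ (@open_interior _ _) xI) oO Oy.
have [_ [w Bw [_ [w' Bw' [t Bt <-]] <-]] Ot] := closure_meets_open
  (interior_subset Iz) (gact_preimage_open v oO) Ovz.
exists (gact (v * (w * w'))%g t); last by rewrite !gactM.
exists (v * (w * w'))%g; last by exists t.
by apply: BU; apply: Bd_mul => //; exact: Bd_mul.
Qed.

End PartialDistance.

(** * Right-invariant metrics *)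

Section Cosets.
Variables (G : topGroupType) (H : set G).

Definition coset_of (g : G) : coset_space H :=
  exist _ (ltrans g H) (mem_set (ex_intro2 _ _ g I erefl)).

Lemma coset_act_of g h : coset_act g (coset_of h) = coset_of (g * h)%g.
Proof. by apply/val_inj; rewrite /= ltransM. Qed.

Lemma coset_ofP (C : coset_space H) : exists g, C = coset_of g.
Proof. by case: C => A hA; have [g _ gA] := set_mem hA; exists g; exact/val_inj. Qed.

End Cosets.

Lemma coset_of_one_inj (G : topGroupType) : injective (coset_of [set 1%g : G]).
Proof.
move=> g h /(congr1 val) /= gh.
have : ltrans g [set 1%g] g by exists 1%g => //; rewrite mulg1.
by rewrite gh => -[_ -> <-]; rewrite mulg1.
Qed.

Lemma coset_ent_relP (G : topGroupType) (H : set G) (E : set (coset_space H * coset_space H)) :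
  entourage E <-> exists2 U, nbhs (1%g : G) U & coset_rel U `<=` E.
Proof. by split=> [[U nU UE]|[U nU UE]]; exists U. Qed.

Section BirkhoffKakutani.
Variables (R : realType) (G : topGroupType) (polishG : polish R G).

Lemma polish_nbhs1_separated (g : G) : (forall U, nbhs (1%g : G) U -> U g) -> g = 1%g.
Proof.
move=> hg; have [_ [d [cd _]]] := polishG; have [[d0 deq _ _] _] := cd.
apply/esym/deq/eqP; rewrite eq_le d0 andbT leNgt; apply/negP => dg.
by have := hg _ (metric_ball_nbhs cd 1%g dg); rewrite /= ltxx.
Qed.

Lemma right_uniformity_countable :
  countable_uniformity (coset_space [set 1%g : G]).
Proof.
have [U [sU baseU]] := polish_nbhs1_base polishG.
apply/countable_uniformityP; exists (fun n => coset_rel (U n)) => [A|n].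
  move=> /coset_ent_relP[V nV VA]; have [n UV] := baseU V nV; exists n.
  by apply: subset_trans VA => CD [u Uu CDu]; exists u => //; exact: UV.
by apply/coset_ent_relP; exists (U n) => //; exact: sym_nbhs1_nbhs.
Qed.

Let T : pseudoMetricType R := countable_uniform right_uniformity_countable.
Let p (g : G) : T := coset_of [set 1%g] g.

Let near (g : G) (e : R) (h : G) := forall k : G, ball (p (g * k)%g) e (p (h * k)%g).
Let S g h := [set e : R | 0 < e /\ near g e h].
Let d g h : R := inf (S g h).

Let S2 g h : S g h 2.
Proof. by split=> // k; exact: countable_uniform.countable_uniform_bounded. Qed.

Let infS g h : has_inf (S g h).
Proof. by split; [exists 2; exact: S2|exists 0 => e [/ltW]]. Qed.

Let d_le g h e : 0 < e -> near g e h -> d g h <= e.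
Proof. by move=> e0 gh; apply: (ge_inf (infS g h).2); split. Qed.

Let d_lt g h e : d g h < e -> near g e h.
Proof.
move=> /(inf_lt (infS g h).1)[f [f0 gh] fe] k.
by apply: le_ball (gh k); exact: ltW.
Qed.

Let near_ent e : 0 < e -> exists2 U, nbhs (1%g : G) U &
  forall g h, U (g * h^-1)%g -> near g e h.
Proof.
move=> e0; have : entourage [set xy : T * T | ball xy.1 e xy.2].
  exact: (@entourage_ball _ _ (PosNum e0)).
move=> /coset_ent_relP[U nU UE]; exists U => // g h Ugh k.
apply: (UE (coset_of _ (g * k)%g, coset_of _ (h * k)%g)).
by exists (g * h^-1)%g => //=; rewrite coset_act_of -mulgA mulKg.
Qed.

Let ent_near U : nbhs (1%g : G) U -> exists2 e, 0 < e &
  forall g h, near g e h -> U (g * h^-1)%g.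
Proof.
move=> nU; have : @entourage T (coset_rel U) by apply/coset_ent_relP; exists U.
rewrite -entourage_ballE => -[e /= e0 eU]; exists e => // g h /(_ 1%g).
rewrite !mulg1 => /(eU (p g, p h))[u Uu] /=; rewrite /p coset_act_of.
by move=> /coset_of_one_inj ->; rewrite mulgK.
Qed.

(** The right uniformity of G, which is that of the cosets of the trivial
    subgroup, has a countable base and hence comes from a pseudometric. Its
    entourages are invariant under right translations, so the supremum of the
    right translates of that pseudometric still induces the topology of G. *)
Lemma birkhoff_kakutani : exists d : G -> G -> R,
  compatible_metric d /\ right_invariant d.
Proof.
have d0 g h : 0 <= d g h by apply: lb_le_inf => [|e [/ltW]]; [exists 2; exact: S2|].
exists d; split; last first.
  move=> x y g; rewrite /d; congr inf; apply/seteqP; split=> e [e0 h]; split=> // k.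
    by have := h (g^-1 * k)%g; rewrite -!mulgA !mulVKg.
  by rewrite -!mulgA; exact: h.
split; first split=> [//|x y|x y|x y z].
- split=> [xy|->]; last first.
    apply/eqP; rewrite eq_le d0 andbT; apply/ler_addgt0Pr => e e0; rewrite add0r.
    by apply: d_le => // k; exact: ballxx.
  have -> // : x = y.
  rewrite -[x](mulgVK y) [(x * _)%g]polish_nbhs1_separated ?mul1g// => U.
  by move=> /ent_near[e e0]; apply; apply: d_lt; rewrite xy.
- rewrite /d; congr inf; apply/seteqP.
  by split=> e [e0 h]; split=> // k; apply: ball_sym; exact: h.
- apply/ler_addgt0Pr => e e0; have e20 : 0 < e / 2 by rewrite divr_gt0.
  have xy : d x y < d x y + e / 2 by rewrite ltrDl.
  have yz : d y z < d y z + e / 2 by rewrite ltrDl.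
  rewrite [e]splitr addrACA; apply: d_le.
    by rewrite addr_gt0// (le_lt_trans (d0 _ _) xy, le_lt_trans (d0 _ _) yz).
  by move=> k; apply: ball_triangle; [exact: (d_lt xy)|exact: (d_lt yz)].
move=> x A; split=> [nA|[e e0 eA]].
  have nU : nbhs (1%g : G) [set u | A (u^-1 * x)%g].
    have c := cvg_comp _ _ (@invg_continuous G 1%g) (@mulg_contr G x _).
    by apply: c; rewrite invg1 mul1g.
  have [e e0 eU] := ent_near nU; exists e => // y /= /d_lt/eU /=.
  by rewrite invgM invgK mulgVK.
have [U nU Ue] := near_ent (divr_gt0 e0 (ltr0n R 2) : 0 < e / 2).
have c := cvg_comp _ _ (@invg_continuous G x) (@mulg_contl G x _).
have : nbhs x [set y | U (x * y^-1)%g] by apply: c; rewrite mulgV.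
apply: filterS => y /Ue hy; apply: eA => /=.
by rewrite (le_lt_trans (d_le _ hy)) ?divr_gt0//; lra.
Qed.

End BirkhoffKakutani.

(** * Points of the Samuel compactification *)

Section SamuelFilter.
Variables (R : realType) (T : uniformType) (phi : samuel R T).
Local Notation bT := (buc R T).

Let phi0 : sa_eval phi 0 = 0.
Proof. by rewrite -[X in sa_eval _ X](subrr 0) sa_evalB subrr. Qed.

Let phiD (f g : bT) : sa_eval phi (f + g) = sa_eval phi f + sa_eval phi g.
Proof.
by have [lphi _] := sa_evalP phi; have := lphi 1 f g; rewrite scale1r mul1r.
Qed.

(** A character phi is recovered from the sublevel sets of the nonnegative
    functions in its kernel: they form the trace on T of the neighbourhood
    filter of phi. *)
Definition sa_null : set (bT * R) :=
  [set he | (forall x, 0 <= buc_val he.1 x) /\ sa_eval phi he.1 = 0 /\ 0 < he.2].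

Definition sa_filter : set_system T :=
  filter_from sa_null (fun he => [set x | buc_val he.1 x < he.2]).

(** If h >= 0 had no value below e then phi h = 0 would contradict positivity of
    phi. *)
Lemma sa_filter_proper : ProperFilter sa_filter.
Proof.
apply: filter_from_proper.
  apply: filter_from_filter.
    by exists (0, 1); split=> //=; split.
  move=> [h e] [k f] [/= h0 [ph e0]] [/= k0 [pk f0]].
  exists (h + k, Num.min e f).
    split=> [x|]; first exact: (addr_ge0 (h0 x) (k0 x)).
    by rewrite /= phiD ph pk addr0 lt_min e0 f0.
  move=> x /= hk; have {}hk : buc_val h x + buc_val k x < Num.min e f by [].
  move: hk; rewrite lt_min => /andP[hke hkf]; split.
    by apply: le_lt_trans hke; rewrite lerDl.
  by apply: le_lt_trans hkf; rewrite lerDr.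
move=> [h e] [/= h0 [ph e0]]; apply: contrapT => he.
have : sa_eval phi (0 - h) <= - e.
  apply: sa_eval_le => x.
  have -> : buc_val (0 - h) x = 0 - buc_val h x by [].
  rewrite sub0r lerN2 leNgt; apply/negP => hx; apply: he; exists x => //.
by rewrite sa_evalB phi0 ph subrr oppr_ge0 leNgt e0.
Qed.

(** The square of f - phi f is nonnegative and in the kernel of phi. *)
Lemma sa_filter_cvg (f : bT) : buc_val f @ sa_filter --> sa_eval phi f.
Proof.
have FF := sa_filter_proper.
apply/cvgrPdist_lt => e e0; pose c := sa_eval phi f.
pose k : bT := f - c *: (1 : bT).
exists (k * k, e ^+ 2) => /=.
  split=> [x|] /=; first exact: sqr_ge0.
  split; last exact: exprn_gt0.
  have [_ [_ ->]] := sa_evalP phi.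
  by rewrite sa_evalB sa_eval_cst subrr mul0r.
move=> x /= kx; have {}kx : (buc_val f x - c * 1) * (buc_val f x - c * 1) < e ^+ 2 by [].
have nn : `|c - buc_val f x| \is Num.nneg by rewrite nnegrE.
have ne : e \is Num.nneg by rewrite nnegrE ltW.
rewrite -(ltr_pXn2r (isT : (0 < 2)%N) nn ne) real_normK ?num_real//.
by rewrite -sqrrN opprB -[c]mulr1 expr2.
Qed.

End SamuelFilter.

Section SamuelPoints.
Variables (R : realType) (G : topGroupType) (H : set G).
Implicit Types phi : samuel R (coset_space H).

Lemma sa_point_cvg phi : @sa_point R G H @ sa_filter phi --> phi.
Proof.
have FF := sa_filter_proper phi.
apply: sa_eval_cvg => f; exact: sa_filter_cvg.
Qed.

Lemma sa_point_closure phi (A : set (coset_space H)) : sa_filter phi A ->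
  closure (@sa_point R G H @` A : set (Sa R H)) phi.
Proof.
move=> FA N /(sa_point_cvg (phi := phi)) FN.
have FF := sa_filter_proper phi.
have [C [AC NC]] := filter_ex (filterI FA FN).
by exists (sa_point R C); split=> //; exists C.
Qed.

Lemma sa_point_dense phi (O : set (Sa R H)) : open O -> O phi ->
  exists g, O (sa_point R (coset_of H g)).
Proof.
move=> oO Ophi; have FF := sa_filter_proper phi.
have [_ [C _ <-] OC] := closure_meets_open
  (sa_point_closure (@filterT _ _ (sa_filter_proper phi))) oO Ophi.
by have [g Cg] := coset_ofP C; exists g; rewrite -Cg.
Qed.

End SamuelPoints.

(** * Continuous functions on a flow *)

Section ContinuousFunctions.
Variables (R : realType) (G : topGroupType) (Y : gflow G).
Implicit Types (y z : Y) (F : Y -> R^o).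

Lemma flow_function_separation y (N : set Y) : nbhs y N ->
  exists F, [/\ continuous F, F y = 0 & forall z, ~ N z -> F z = 1].
Proof.
move=> nN; have hY := @gflow_hausdorff _ Y.
have cY : normal_space Y := compact_normal hY (@gflow_compact _ Y).
have cl : closed (~` interior N) by apply: open_closedC; exact: open_interior.
have ny : ~ (~` interior N) y by move=> h; apply: h; exact: nN.
have sep := normal_completely_regular cY (hausdorff_accessible hY) cl ny.
have [F [cF _ F0 F1]] := (@uniform_separatorP _ R _ _).1 (sep R).
exists F; split=> //; first by apply: F0; exists y.
by move=> z nz; apply: F1; exists z => // /interior_subset.
Qed.

Lemma flow_function_inj y z : (forall F, continuous F -> F y = F z) -> y = z.
Proof.
move=> yz; apply: (@gflow_hausdorff _ Y) => A B nA nB.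
exists z; split; last exact: nbhs_singleton.
apply: contrapT => nAz; have [F [cF F0 F1]] := flow_function_separation nA.
by have := yz F cF; rewrite F0 F1// => /eqP; rewrite eq_sym oner_eq0.
Qed.

(** This is what makes a continuous function uniformly continuous along orbits. *)
Lemma flow_function_unif F (e : R) : continuous F -> 0 < e ->
  exists2 U, nbhs (1%g : G) U &
    forall u y, U u -> `|F (gact u y) - F y| < e.
Proof.
move=> cF e0; have /compact_near_coveringP cov := @gflow_compact _ Y.
exists [set u | [set: Y] `<=` [set y | `|F (gact u y) - F y| < e]]; last first.
  by move=> u y; apply.
apply: (cov G (nbhs (1%g : G)) (fun u y => `|F (gact u y) - F y| < e) _) => y _.
 have e20 : 0 < e / 2 by rewrite divr_gt0.
have /cvgrPdist_lt/(_ _ e20) nF : F @ y --> F y := cF y.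
have nF' : nbhs (gact 1%g y) [set z | `|F y - F z| < e / 2] by rewrite gact1.
have [U [B [nU nB UB]]] := gact_near nF'.
exists (B `&` [set z | `|F y - F z| < e / 2], U) => /=.
  by split=> //; exact: filterI.
move=> [z u] [/= [Bz yz] Uu] /=; have uz := UB u z Uu Bz.
rewrite (_ : F _ - F z = (F y - F z) - (F y - F (gact u z))); last first.
  by rewrite opprB [RHS]addrC [RHS]addrA subrK.
by rewrite [e]splitr (le_lt_trans (ler_normB _ _))// ltrD.
Qed.

Lemma flow_function_bounded F : continuous F -> exists M, forall y, `|F y| <= M.
Proof.
move=> cF; pose O (n : nat) := [set y | `|F y| < n%:R].
have oO n : open (O n).
  have c : continuous (fun y => `|F y| : R^o).
    by move=> y; apply: cvg_norm; exact: cF.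
  by have /continuousP/(_ _ (@open_lt R n%:R)) := c.
have [D fD hD] := compact_finite_subcover (@gflow_compact _ Y) oO
  (fun y => ex_intro (O^~ y) _ (truncnS_gt `|F y|)).
have [M DM] : exists M, forall n, D n -> (n <= M)%N.
  have [s Ds] := (finite_seqP D).1 fD; exists (\max_(n <- s) n)%N => n.
  by rewrite Ds => /= ns; exact: leq_bigmax_seq.
exists M%:R => y; have [n Dn /ltW/le_trans] := hD y; apply.
by rewrite ler_nat; exact: DM.
Qed.

End ContinuousFunctions.

(** * The universal property of the Samuel compactification *)

Section SamuelUniversal.
Variables (R : realType) (G : topGroupType) (H : set G) (Y : gflow G) (y0 : Y).
Hypotheses (H1 : H 1%g) (Hy0 : forall h, H h -> gact h y0 = y0).
Implicit Types (F : Y -> R^o) (phi : samuel R (coset_space H)).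

Let q (C : coset_space H) : Y := gact (xget 1%g (val C)) y0.

Let q_of g : q (coset_of H g) = gact g y0.
Proof.
rewrite /q; case: xgetP => [_ -> [h Hh <-]|/(_ g)]; first by rewrite gactM Hy0.
by case; exists 1%g; rewrite ?mulg1.
Qed.

Let q_act g C : q (coset_act g C) = gact g (q C).
Proof. by have [k ->] := coset_ofP C; rewrite coset_act_of !q_of gactM. Qed.

Let pull_buc F : continuous F -> (F \o q : coset_space H -> R^o) \in @buc_pred R _.
Proof.
move=> cF; apply/buc_predP; split; last first.
  by have [M FM] := flow_function_bounded cF; exists M => C; exact: FM.
move=> e e0; have [U nU UF] := flow_function_unif cF e0.
exists (coset_rel U); first by apply/coset_ent_relP; exists U.
by move=> C D [u Uu /= ->]; rewrite q_act; exact: UF.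
Qed.

Let pull F (cF : continuous F) : buc R (coset_space H) := BUC (pull_buc cF).

(* A cluster point in Y of the filter of phi; its values under continuous
   functions are forced, so it is determined by phi. *)
Let ext_exists phi : exists y, forall F (cF : continuous F),
  F y = sa_eval phi (pull cF).
Proof.
have FF := sa_filter_proper phi.
have [y [_ qy]] := @gflow_compact _ Y _ (fmap_proper_filter q FF) filterT.
exists y => F cF; apply: (@norm_hausdorff R R^o) => A B nA nB.
have qB : (q @ sa_filter phi) (q @` [set C | B (F (q C))]).
  have fB := @sa_filter_cvg R _ phi (pull cF) _ nB.
  by apply: (@filterS _ (sa_filter phi) FF _ _ _ fB) => C BC; exists C.
have [_ [[C BC <-] AC]] := qy _ _ qB (cF y A nA).
by exists (F (q C)).
Qed.

Let ext phi : Y := sval (cid (ext_exists phi)).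

Let extE phi F (cF : continuous F) : F (ext phi) = sa_eval phi (pull cF).
Proof. exact: (svalP (cid (ext_exists phi))). Qed.

(** Composing with g H |-> g y0 turns continuous functions on Y into bounded
    uniformly continuous functions on G/H. A character of the latter algebra
    thus gives a character of C(Y), which is evaluation at a point of Y. *)
Lemma samuel_universal : exists S : Sa R H -> Y,
  gmap S /\ forall g, S (sa_point R (coset_of H g)) = gact g y0.
Proof.
exists ext; split; last first.
  move=> g; apply: (@flow_function_inj R) => F cF.
  by rewrite (extE _ cF) -q_of.
split=> [phi N nN|g phi].
  have [F [cF F0 F1]] := flow_function_separation R nN.
  have := @sa_eval_continuous R _ (pull cF) phi.
  move=> /cvgrPdist_lt/(_ _ ltr01); apply: filterS => psi.
  rewrite -!extE F0 sub0r normrN => Fpsi; apply: contrapT => /F1 F1psi.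
  by move: Fpsi; rewrite F1psi normr1 ltxx.
apply: (@flow_function_inj R) => F cF.
have cFg : continuous (F \o gact g : Y -> R^o).
  by move=> y; exact: (cvg_comp _ _ (@gact_contr _ _ g y) (cF _)).
rewrite (extE _ cF) -[F (gact g _)]/((F \o gact g) _) (extE _ cFg).
by congr (sa_eval phi _); apply/val_inj/funext => C /=; rewrite q_act.
Qed.

End SamuelUniversal.

(** * Maps of flows *)

Section FlowIso.
Variables (G : topGroupType).

Lemma flow_iso_sym (X Y : gflow G) : flow_iso X Y -> flow_iso Y X.
Proof. by move=> [f [g [gf gg fK gK]]]; exists g, f. Qed.

Lemma bijective_gmap_flow_iso (X Y : gflow G) (f : X -> Y) :
  gmap f -> injective f -> range f = setT -> flow_iso X Y.
Proof.
move=> [cf ef] injf surjf.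
have pre y : exists x, f x = y.
  by have [x _ <-] : range f y by [rewrite surjf]; exists x.
pose g y := sval (cid (pre y)).
have gK : cancel g f by move=> y; exact: (svalP (cid (pre y))).
have fK : cancel f g by move=> x; apply: injf; rewrite gK.
exists f, g; split=> //; split=> [y N|h y]; last by apply: injf; rewrite ef !gK.
rewrite nbhsE => -[O [oO Ogy] ON].
have cO : compact (~` O).
  apply: (subclosed_compact _ (@gflow_compact _ X)) => //.
  exact: open_closedC.
have cfO : closed (f @` (~` O)).
  apply: (compact_closed (@gflow_hausdorff _ Y)).
  apply: continuous_compact cO; apply: continuous_subspaceT; exact: cf.
apply: (@filterS _ (nbhs y) _ (~` (f @` (~` O)))).
  by move=> z nz; apply: ON; apply: contrapT => nO; apply: nz; exists (g z).
apply: open_nbhs_nbhs; split; first by rewrite openC.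
by move=> [x nOx fxy]; apply: nOx; rewrite -[x]fK fxy.
Qed.

Lemma locally_dense_orbit_iso (X Y : gflow G) (f : X -> Y) (g : Y -> X) x :
  gmap f -> gmap g -> cancel f g -> cancel g f ->
  locally_dense_orbit x -> locally_dense_orbit (f x).
Proof.
move=> [cf ef] [cg eg] fK gK hx U nU.
have oI : open (g @^-1` interior (closure (setact U [set x]))).
  by have /continuousP := cg; apply; exact: open_interior.
apply: (interior_mem_open oI) => /=; first by rewrite fK; exact: hx.
move=> y /= /interior_subset hy; apply: closure_of_open_meets => O oO Oy.
have oO' : open (f @^-1` O) by have /continuousP/(_ _ oO) := cf.
have Ogy : (f @^-1` O) (g y) by rewrite /= gK.
have [_ [u Uu [_ -> <-]] Oux] := closure_meets_open hy oO' Ogy.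
by exists (gact u (f x)); [exists u => //; exists (f x)|rewrite -ef].
Qed.

Lemma gmap_onto_minimal (X Y : gflow G) (f : X -> Y) (x0 : X) :
  minimal_flow Y -> gmap f -> range f = setT.
Proof.
move=> [_ mY] [cf ef]; apply/seteqP; split=> // y _.
have cl : closed (range f).
  apply: (compact_closed (@gflow_hausdorff _ Y)).
  apply: continuous_compact (@gflow_compact _ X).
  by apply: continuous_subspaceT; exact: cf.
apply: cl; apply: closure_of_open_meets => O oO Oy.
have [_ [g _ <-] Og] := dense_meets_open (mY (f x0)) oO Oy.
by exists (gact g (f x0)) => //; exists (gact g x0).
Qed.

End FlowIso.

(** * The base point of the Samuel compactification of a coset space *)

Section SamuelLocallyDense.
Variables (R : realType) (G : topGroupType) (d : G -> G -> R) (H : set G).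
Hypotheses (cd : compatible_metric d) (rd : right_invariant d).
Hypothesis sH : is_subgroup H.

Let H1 : H 1%g. Proof. by have [] := sH. Qed.

(* Truncation at 1 makes the distance bounded. *)
Let m (g : G) : R := Num.min (d g 1%g) 1.

Let m_ge0 g : 0 <= m g.
Proof. by have [[d0 _ _ _] _] := cd; rewrite /m le_min d0 ler01. Qed.

Let m_mul u g : m (u * g)%g <= d u 1%g + m g.
Proof.
have [[d0 _ _ _] _] := cd.
have h : d (u * g)%g 1%g <= d u 1%g + d g 1%g.
  apply: le_trans (compatible_metric_triangle cd g _ _) _.
  by rewrite lerD2r -{2}[g]mul1g rd.
rewrite /m; have := d0 u 1%g; have [] := leP (d g 1%g) 1 => [_ _|_ ud0].
  by rewrite ge_min h.
by rewrite ge_min lerDr ud0 orbT.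
Qed.

Let D (C : coset_space H) : R := inf (m @` val C).

Let m_inf (C : coset_space H) : has_inf (m @` val C).
Proof.
split; last by exists 0 => _ [g _ <-].
by have [g ->] := coset_ofP C; exists (m (g * 1)%g), (g * 1)%g => //; exists 1%g.
Qed.

Let D_le g (C : coset_space H) : (val C : set G) g -> D C <= m g.
Proof. by move=> Cg; apply: (ge_inf (m_inf C).2); exists g. Qed.

Let D_act u (C : coset_space H) : D (coset_act u C) <= d u 1%g + D C.
Proof.
rewrite -lerBlDl; apply: lb_le_inf; first exact: (m_inf C).1.
move=> _ [g Cg <-]; rewrite lerBlDl; apply: le_trans (m_mul u g).
by apply: D_le; exists g.
Qed.

Let D_buc : (D : coset_space H -> R^o) \in @buc_pred R _.
Proof.
apply/buc_predP; split; last first.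
  exists 1 => C; have [g Cg] : (val C : set G) !=set0.
    by have [g ->] := coset_ofP C; exists (g * 1)%g; exists 1%g.
  rewrite ger0_norm.
    by apply: le_trans (D_le Cg) _; rewrite /m ge_min lexx orbT.
  by apply: lb_le_inf; [exact: (m_inf C).1|move=> _ [h _ <-]].
move=> e e0; exists (coset_rel (Bd d e)).
  by apply/coset_ent_relP; exists (Bd d e) => //; exact/sym_nbhs1_nbhs/Bd_sym_open.
move=> C K [u ue /= ->]; have iu : d u^-1%g 1%g = d u 1%g.
  by rewrite -(rd _ _ u) mulVg mul1g (compatible_metric_sym cd).
rewrite ltr_distl; apply/andP; split; last first.
  by apply: le_lt_trans (D_act u K) _; rewrite addrC ltrD2l.
have := D_act u^-1%g (coset_act u K); rewrite -coset_actM mulVg coset_act1 iu.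
by rewrite ltrBlDr => /le_lt_trans; apply; rewrite addrC ltrD2l.
Qed.

(** The truncated distance D(C) from 1 to the coset C is uniformly continuous, so
    it extends to Sa(G/H), and {D < r} is a neighbourhood of the base point. The
    points of G/H are dense in it, and those which lie in it are translates of
    the base point by elements of the r-ball of G. *)
Lemma sa_point_locally_dense :
  locally_dense_orbit (sa_point R (coset_of H 1%g) : Sa R H).
Proof.
move=> U nU; have [e e0 eU] := nbhs_metric_ball cd nU.
pose f : buc R (coset_space H) := BUC D_buc.
pose r := Num.min e 1; have r0 : 0 < r by rewrite lt_min e0 ltr01.
pose O : set (Sa R H) := [set phi | sa_eval phi f < r].
have oO : open O.
  by have /continuousP/(_ _ (@open_lt R r)) := @sa_eval_continuous R _ f.
have Op : O (sa_point R (coset_of H 1%g)).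
  have : D (coset_of H 1%g) <= m 1%g.
    by apply: D_le; exists 1%g; rewrite ?mulg1.
  rewrite /m (compatible_metric_refl cd) => D0.
  change (D (coset_of H 1%g) < r); apply: le_lt_trans D0 _.
  by rewrite gt_min r0.
apply: (interior_mem_open oO Op) => psi Opsi.
apply: closure_of_open_meets => O' oO' O'psi.
have [g [Og O'g]] := sa_point_dense (openI oO oO') (conj Opsi O'psi).
have {}Og : D (coset_of H g) < r by [].
have [_ [c [h Hh <-] <-] mc] := inf_lt (m_inf _).1 Og.
exists (sa_point R (coset_of H g)) => //; exists (g * h)%g.
  apply: eU => /=; rewrite (compatible_metric_sym cd); move: mc.
  by rewrite /m /r lt_min !gt_min ltxx orbF => /andP[/orP[//|e1] d1]; exact: lt_trans e1.
exists (sa_point R (coset_of H 1%g)) => //; rewrite /= sa_act_point coset_act_of mulg1.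
congr (sa_point _ _); apply/val_inj => /=; have [_ HM HV] := sH.
apply/seteqP; split=> [_ [k Hk <-]|_ [k Hk <-]].
  by exists (h * k)%g; [exact: HM|rewrite mulgA].
by exists (h^-1 * k)%g; [apply: HM => //; exact: HV|rewrite -mulgA mulVKg].
Qed.

End SamuelLocallyDense.

(** * Flows with a locally dense orbit as Samuel compactifications *)

Lemma locally_dense_orbit_translate (G : topGroupType) (X : gflow G) (x : X) g :
  locally_dense_orbit x -> locally_dense_orbit (gact g x).
Proof.
move=> hx U; rewrite nbhsE => -[V [oV V1] VU].
have oW : open [set h | V (h * g^-1)%g].
  by have /continuousP/(_ V oV) := @mulg_contr G g^-1%g.
have Wg : V (g * g^-1)%g by rewrite mulgV.
apply: filterS (locally_dense_orbit_gact hx oW Wg); apply: closureS.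
move=> _ [h Vh [_ -> <-]]; exists (h * g^-1)%g; first exact: VU.
by exists (gact g x) => //; rewrite -gactM mulgVK.
Qed.

Section Stabilizer.
Variables (R : realType) (G : topGroupType) (polishG : polish R G).
Variables (X : gflow G) (x : X).
Hypotheses (mX : minimal_flow X) (hx : locally_dense_orbit x).

Definition stabilizer : set G := [set g | gact g x = x].

Lemma stabilizer_subgroup : is_subgroup stabilizer.
Proof.
split=> [|g h gx hx'|g gx]; rewrite /stabilizer /=; first exact: gact1.
  by rewrite gactM hx'.
by rewrite -{1}gx gactK.
Qed.

Lemma stabilizer_closed : closed stabilizer.
Proof.
move=> g clg; apply: (@gflow_hausdorff _ X) => A B nA nB.
have [h [hx' Ah]] := clg _ (gact_contl nA).
by exists x; split; [rewrite -hx'|exact: nbhs_singleton].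
Qed.

(** Choose a neighbourhood N of x whose points in the orbit belong to U x.
    Finitely many translates of N cover X by minimality. *)
Lemma stabilizer_presyndetic : presyndetic stabilizer.
Proof.
move=> U nU; have [N [oN Nx hN]] := locally_dense_orbit_open polishG hx nU.
have [D fD hD] := compact_finite_subcover (@gflow_compact _ X)
  (f := fun g => [set y | N (gact g^-1%g y)])
  (fun g => gact_preimage_open g^-1%g oN)
  (fun y => let: ex_intro g Ng := minimal_orbit_meets y mX oN (ex_intro _ x Nx) in
    ex_intro (fun h => N (gact h^-1%g y)) g^-1%g
      (eq_ind_r (fun h => N (gact h y)) Ng (invgK g))).
exists D; split=> //; apply/seteqP; split=> // g _.
have [f Df /=] := hD (gact g x); rewrite -gactM => /hN[u Uu fgx].
exists (f * u)%g; first by exists f => //; exists u.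
exists ((f * u)^-1 * g)%g; last by rewrite mulVKg.
by rewrite /stabilizer /= invgM -mulgA gactM fgx gactK.
Qed.

Lemma stabilizer_coset g h : gact g x = gact h x ->
  coset_of stabilizer g = coset_of stabilizer h.
Proof.
have sub k l : gact k x = gact l x -> ltrans k stabilizer `<=` ltrans l stabilizer.
  move=> kl _ [s sx <-]; exists (l^-1 * (k * s))%g; last by rewrite mulVKg.
  by rewrite /stabilizer /= !gactM sx kl gactK.
by move=> gh; apply/val_inj/seteqP; split; apply: sub.
Qed.

Section Trace.
Variable f : buc R (coset_space stabilizer).

(** The largest open subset of X on whose orbit points the function g x |-> f(gH)
    has values in P. *)
Definition trace_open (P : set R^o) : set X :=
  \bigcup_(N in [set N : set X | open N /\
    forall g, N (gact g x) -> P (buc_val f (coset_of stabilizer g))]) N.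

Lemma trace_open_open P : open (trace_open P).
Proof. by apply: bigcup_open => N []. Qed.

(** Since the orbit map is open onto its image, f is continuous on the orbit for
    the topology of X. *)
Lemma trace_openP P g : open P ->
  trace_open P (gact g x) <-> P (buc_val f (coset_of stabilizer g)).
Proof.
move=> oP; split=> [[N [_ hN] /hN]//|Pg].
have /(nbhs_ballP (buc_val f (coset_of stabilizer g) : R^o))[e /= e0 eP] :=
  open_nbhs_nbhs (conj oP Pg).
have /buc_predP[uf _] := bucP f.
have [E /coset_ent_relP[U nU UE] Ef] := uf e e0.
have [N [oN Ng hN]] :=
  locally_dense_orbit_open polishG (@locally_dense_orbit_translate _ _ _ g hx) nU.
exists N => //; split=> // k Nk; apply: eP => /=.
have [|u Uu kg] := hN (k * g^-1)%g; first by rewrite -gactM mulgVK.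
rewrite /ball /= distrC; apply: Ef; apply: UE; exists u => //=.
by rewrite coset_act_of; apply: stabilizer_coset; rewrite -gactM mulgVK in kg; rewrite kg gactM.
Qed.

(** Values below r and values above s cannot be joined by a small group element,
    because f is uniformly continuous; the G-ED property then separates the
    closures. In effect, f extends continuously to X. *)
Lemma trace_open_disjoint_closure r s y : G_ED X -> r < s ->
  closure (trace_open [set t : R^o | t < r]) y ->
  closure (trace_open [set t : R^o | s < t]) y -> False.
Proof.
move=> ED rs yr ys; have rs0 : 0 < s - r by rewrite subr_gt0.
have /buc_predP[uf _] := bucP f.
have [E /coset_ent_relP[U nU UE] Ef] := uf _ rs0.
apply: (G_ED_separation ED (trace_open_open _) (trace_open_open _) nU _ yr ys).
apply/seteqP; split=> // z [Or [u Uu [w Ow uwz]]]; rewrite -uwz in Or => {uwz}.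
have [_ [g _ <-] [gs gr]] := dense_meets_open (proj2 mX x)
  (openI (trace_open_open _) (gact_preimage_open u (trace_open_open _)))
  (conj Ow Or).
move: gs => /(trace_openP _ (@open_gt R s)) /= gs.
move: gr; rewrite /= -gactM => /(trace_openP _ (@open_lt R r)) /= gr.
have : `|buc_val f (coset_of stabilizer (u * g)%g) -
         buc_val f (coset_of stabilizer g)| < s - r.
  by apply: Ef; apply: UE; exists u => //=; rewrite coset_act_of.
rewrite ltr_norml => /andP[+ _].
by move=> h; suff : False by []; move: h gr gs => /=; lra.
Qed.

End Trace.

(** The canonical map S from Sa(G/H) onto X is injective: if f separates phi and
    psi, then the image of phi is a limit of orbit points where f takes values
    near phi f, the image of psi is one of orbit points where f takes values
    near psi f, and these limits are distinct. *)
Lemma locally_dense_orbit_samuel : G_ED X -> flow_iso X (Sa R stabilizer).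
Proof.
move=> ED; apply: flow_iso_sym.
have [S [gS Sp]] := @samuel_universal R G stabilizer X x (@gact1 _ X x) (fun h hh => hh).
have [cS eS] := gS.
have sub phi psi f : S phi = S psi -> sa_eval psi f <= sa_eval phi f.
  move=> Seq; rewrite leNgt; apply/negP => lt_f.
  have clos chi (P : set R^o) : open P -> P (sa_eval chi f) ->
      closure (trace_open f P) (S chi).
    move=> oP Pchi; apply: closure_of_open_meets => O oO Ochi.
    have fP := @sa_filter_cvg R _ chi f _ (open_nbhs_nbhs (conj oP Pchi)).
    have oO' : open (S @^-1` O) by have /continuousP/(_ _ oO) := cS.
    have [_ [C PC <-] OC] := closure_meets_open (sa_point_closure fP) oO' Ochi.
    have [g Cg] := coset_ofP C; exists (gact g x); last by rewrite -Sp -Cg.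
    by apply/trace_openP => //; rewrite -Cg.
  (* Two thresholds strictly between the values of phi and psi at f. *)
  pose r := (2 * sa_eval phi f + sa_eval psi f) / 3.
  pose s := (sa_eval phi f + 2 * sa_eval psi f) / 3.
  have rs : r < s by rewrite /r /s; lra.
  apply: (trace_open_disjoint_closure ED rs (y := S phi)).
    by apply: clos; [exact: open_lt|rewrite /r /=; lra].
  by rewrite Seq; apply: clos; [exact: open_gt|rewrite /s /=; lra].
apply: (bijective_gmap_flow_iso gS) => [phi psi Seq|].
  by apply/sa_eval_inj/funext => f; apply/eqP; rewrite eq_le !sub.
exact: (@gmap_onto_minimal _ (Sa R stabilizer) X S (sa_point R (coset_of _ 1%g)) mX gS).
Qed.

End Stabilizer.

(** * Existence of the universal minimal flow *)

Section MinimalSubflow.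
Variables (G : topGroupType) (A : gflow G).

Section Subflow.
Variable K : set A.
Hypotheses (cK : closed K) (iK : forall g x, K x -> K (gact g x)).

Let sub_act_subproof (g : G) (z : set_type K) : gact g (val z) \in K.
Proof. by rewrite inE; apply: iK; case: z => z /= /set_mem. Qed.

Let sub_act g (z : set_type K) : set_type K := 
  exist _ (gact g (val z)) (sub_act_subproof g z).

Let sub_nbhs (z : set_type K) (N : set (set_type K)) : nbhs z N ->
  exists O : set A, [/\ open O, O (val z) & val @^-1` O `<=` N].
Proof. by move=> [_ [[O oO <-]] Oz ON]; exists O. Qed.

Let sub_val_continuous : continuous (val : set_type K -> A).
Proof. exact: initial_continuous. Qed.

Let sub_act1 z : sub_act 1%g z = z.
Proof. by apply/val_inj; rewrite /= gact1. Qed.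

Let sub_actM g h z : sub_act (g * h)%g z = sub_act g (sub_act h z).
Proof. by apply/val_inj; rewrite /= gactM. Qed.

Let sub_act_continuous : continuous (fun p : G * set_type K => sub_act p.1 p.2).
Proof.
move=> [g z] N /sub_nbhs[O [oO Oz ON]].
have [U [B [nU nB UB]]] := gact_near (open_nbhs_nbhs (conj oO Oz)).
exists (U, val @^-1` B) => /=; first by split=> //; exact: sub_val_continuous.
by move=> [u y] [/= Uu By]; apply: ON; exact: UB.
Qed.

Let sub_compact : compact [set: set_type K].
Proof.
move=> F FF _.
have vK : (val @ F) K by apply: (@filterE _ F) => z; case: z => z /= /set_mem.
have ccK : compact K := subclosed_compact cK (@gflow_compact _ A) (fun _ _ => I).
have [z [Kz clz]] := ccK _ (fmap_proper_filter val FF) vK.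
exists (exist _ z (mem_set Kz)); split=> // S N FS /sub_nbhs[O [oO Oz ON]].
have vS : (val @ F) (val @` S) by apply: (@filterS _ F _ _ _ _ FS) => y Sy; exists y.
have [_ [[y Sy <-] Oy]] := clz _ _ vS (open_nbhs_nbhs (conj oO Oz)).
by exists y; split=> //; exact: ON.
Qed.

Let sub_hausdorff : hausdorff_space (set_type K).
Proof.
move=> y z yz; apply/val_inj/(@gflow_hausdorff _ A) => B C nB nC.
have [w [Bw Cw]] := yz _ _ (sub_val_continuous nB) (sub_val_continuous nC).
by exists (val w).
Qed.

Definition subflow : gflow G :=
  GFlow sub_act1 sub_actM sub_act_continuous sub_compact sub_hausdorff.

Definition subflow_val : subflow -> A := val.

Lemma subflow_val_gmap : gmap subflow_val.
Proof. by split=> //; exact: sub_val_continuous. Qed.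

Lemma subflow_minimal : K !=set0 ->
  (forall L, closed L -> (forall g x, L x -> L (gact g x)) -> L !=set0 ->
    L `<=` K -> K `<=` L) -> minimal_flow subflow.
Proof.
move=> [k Kk] minK; split; first by exists (exist _ k (mem_set Kk)).
move=> z O [w Ow] oO.
have /sub_nbhs[B [oB Bw BO]] : nbhs w O by exact: open_nbhs_nbhs.
have Kz : K (val z) by case: (z) => y /= /set_mem.
have Kw : K (val w) by case: (w) => y /= /set_mem.
have cl_act g y : closure (Defs.orbit (val z : A)) y ->
    closure (Defs.orbit (val z : A)) (gact g y).
  move=> /(@gact_closure _ _ g); apply: closureS => _ [_ [h _ <-] <-].
  by exists (g * h)%g; rewrite ?gactM.
have KL : K `<=` closure (Defs.orbit (val z : A)).
  apply: minK => //; first exact: closed_closure.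
    by exists (val z); apply: subset_closure; exists 1%g; rewrite ?gact1.
  rewrite [X in _ `<=` X](closure_id K).1//; apply: closureS => _ [g _ <-].
  exact: iK.
have [_ [g _ <-] Bg] := closure_meets_open (KL _ Kw) oB Bw.
by exists (sub_act g z); split; [exact: BO|exists g].
Qed.

End Subflow.

(** The complement of a minimal set is a maximal proper invariant open set. The
    union of a chain of proper open sets is proper by compactness. *)
Lemma exists_minimal_subflow : [set: A] !=set0 ->
  exists (M : gflow G) (i : M -> A), minimal_flow M /\ gmap i.
Proof.
move=> [a _].
pose P (O : set A) := [/\ open O, forall g x, O (gact g x) -> O x & O <> setT].
have [F FP totF|O [[oO iO OT] maxO]] := @Zorn_bigcup A P.
  split; first by apply: bigcup_open => O /FP[].
    by move=> g x [O FO Ogx]; exists O => //; have [_ h _] := FP _ FO; exact: h Ogx.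
  move=> FT; have [O0 FO0 _] : (\bigcup_(O in F) O) a by rewrite FT.
  pose FF := filter_from F (fun O => [set O' | F O' /\ O `<=` O']).
  have fFF : Filter FF.
    apply: filter_from_filter; first by exists O0.
    move=> O1 O2 F1 F2; have [O12|O21] := totF _ _ F1 F2.
      by exists O2 => // O [FO O2O]; do !split => //; exact: subset_trans O2O.
    by exists O1 => // O [FO O1O]; do !split => //; exact: subset_trans O1O.
  have /compact_near_coveringP cov := @gflow_compact _ A.
  have [|O FO OT] := cov _ FF (fun O y => O y) fFF.
    move=> y _; have [O FO Oy] : (\bigcup_(O in F) O) y by rewrite FT.
    have [oO _ _] := FP _ FO.
    exists (O, [set O' | F O' /\ O `<=` O']) => /=.
      by split; [exact: open_nbhs_nbhs|exists O].
    by move=> [z O'] /= [Oz [_ OO']]; exact: OO'.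
  have [_ _] := FP _ FO; apply; apply/seteqP; split=> // y _.
  exact: (OT O (conj FO (@subset_refl _ O)) y I).
have cK : closed (~` O) by exact: open_closedC.
have iK g x : (~` O) x -> (~` O) (gact g x).
  by move=> nO Ogx; apply: nO; exact: iO Ogx.
exists (subflow cK iK), (@subflow_val _ cK iK); split; last exact: subflow_val_gmap.
apply: subflow_minimal.
  by apply/set0P/eqP => h; apply: OT; rewrite -[O]setCK h setC0.
move=> L cL iL [l Ll] LK; apply: contrapT => nKL.
apply: (maxO (~` L)).
  split; first by move=> y Oy Ly; exact: LK Ly Oy.
  by move=> h; apply: nKL; rewrite -[L]setCK; exact: subsetC.
split; first by rewrite openC.
  by move=> g x nL Lx; apply: nL; exact: iL.
by move=> LT; suff : (~` L) l by []; rewrite LT.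
Qed.

End MinimalSubflow.

(** Any minimal subflow of Sa(G): the map of Sa(G) onto a minimal flow Y that
    sends the identity to a point of Y remains onto when restricted. *)
Lemma exists_universal_minimal_flow (R : realType) (G : topGroupType) :
  exists M : gflow G, universal_minimal_flow M.
Proof.
pose A := Sa R [set 1%g : G].
have [M [i [mM [ci ei]]]] := exists_minimal_subflow
  (ex_intro [set: A] (sa_point R (coset_of _ 1%g)) I).
exists M; split=> // Y mY; have [[y _] _] := mY.
have Hy h : [set 1%g : G] h -> gact h y = y by move=> ->; exact: gact1.
have [S [[cS eS] _]] := samuel_universal R (erefl : [set 1%g : G] 1%g) Hy.
have gf : gmap (S \o i).
  split=> [z|g z]; last by rewrite /= ei eS.
  exact: (cvg_comp _ _ (ci z) (cS _)).
exists (S \o i); split=> //; have [[z _] _] := mM.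
exact: gmap_onto_minimal z mY gf.
Qed.

(** * The equivalence *)

Theorem theorem7p7 (R : realType) (G : topGroupType) (polishG : polish R G) :
  (forall X : gflow G, minimal_flow X -> G_ED X ->
    [<-> rosendal X;
         has_comeager_orbit X;
         exists x : X, first_countable_at x;
         exists x : X, G_isolated x;
         forall d : G -> G -> R, compatible_metric d -> right_invariant d ->
           exists x : X, partial_compatible d x;
         exists H : set G,
           [/\ is_subgroup H, closed H, presyndetic H & flow_iso X (Sa R H)]])
  /\ (TMD G <-> GPP R G).
Proof.
have to_rosendal (X : gflow G) (x : X) : minimal_flow X ->
    locally_dense_orbit x -> rosendal X.
  by move=> mX /locally_dense_orbit_U_TT_at; exact: U_TT_at_rosendal.
split=> [X mX ED|].
  have [X0 _] := mX; tfae.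
  - move=> /(rosendal_exists_locally_dense polishG mX)[x hx].
    by exists x; exact: (locally_dense_orbit_comeager polishG mX hx).
  - move=> [x /(comeager_orbit_locally_dense polishG)/locally_dense_orbit_U_TT_at].
    by move=> /(U_TT_at_first_countable polishG); exists x.
  - by move=> [x /(first_countable_G_isolated ED)]; exists x.
  - by move=> [x hx] d cd rd; exists x; exact: G_isolated_partial_compatible.
  - have [d [cd rd]] := birkhoff_kakutani polishG.
    move=> /(_ d cd rd)[x /(partial_compatible_U_TT_at cd rd ED)].
    move=> /(U_TT_at_rosendal mX)/(rosendal_exists_locally_dense polishG mX).
    move=> {x} [x hx]; exists (stabilizer x); split.
    + exact: stabilizer_subgroup.
    + exact: stabilizer_closed.
    + exact: (stabilizer_presyndetic polishG).
    + exact: (locally_dense_orbit_samuel polishG).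
  - move=> [H [sH _ _ [f [g [gf gg fK gK]]]]].
    have [d [cd rd]] := birkhoff_kakutani polishG.
    apply: (to_rosendal X (g (sa_point R (coset_of H 1%g))) mX).
    apply: (locally_dense_orbit_iso gg gf gK fK).
    exact: sa_point_locally_dense cd rd sH.
split=> [[_ [M [[mM uM] rM]]]|[_ hG]].
  split=> // X mX; have [f [gf sf]] := uM X mX.
  have [m hm] := rosendal_exists_locally_dense polishG mM rM.
  exists (f m); apply: (locally_dense_orbit_comeager polishG mX).
  exact: (locally_dense_orbit_factor polishG mM gf sf hm).
split; first exact: polish_hausdorff polishG.
have [M [mM uM]] := exists_universal_minimal_flow R G.
exists M; split=> //; have [m] := hG M mM.
by move=> /(comeager_orbit_locally_dense polishG); exact: to_rosendal.
Qed.
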